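(* Let $j>0$, $R\in(0,1)$, and for $\delta>0$ small let $\rho_\delta$ be the unique function, continuous on $[0,R]$ and vanishing on $(R,1]$, such that $u=j\delta D_0+\rho_\delta$ is a fixed point of $S^{(\delta,-)}_\delta$ with cut point $R^{(\delta)}_{G^{\rm neum}_\delta*u}=R$. Then for every $r\in[0,R]$, $$\lim_{\delta\to0}\rho_\delta(r)=2j(R-r).$$
   Context: $D_0$ is the Dirac delta at $0$. $G^{\rm neum}_t(r,r')$ is the Green function of $\partial_t\rho=\frac12\partial_r^2\rho$ on $[0,1]$ with Neumann boundary conditions, $G^{\rm neum}_t(r,r')=\sum_kG_t(r,r'_k)$ with $G_t(r,r')=e^{-(r-r')^2/2t}/\sqrt{2\pi t}$ and $r'_k$ the images of $r'$ under repeated reflections of $[0,1]$. For $u=cD_0+\rho$, $(G^{\rm neum}_\delta*u)(r)=cG^{\rm neum}_\delta(r,0)+\int_0^1G^{\rm neum}_\delta(r,r')\rho(r')dr'$. The cut-and-paste map is $K^{(\delta)}u=j\delta D_0+\mathbf 1_{r\in[0,R^{(\delta)}_u]}u$ with $\int_{R^{(\delta)}_u}^1u=j\delta$, and $S^{(\delta,-)}_\delta(u)=K^{(\delta)}(G^{\rm neum}_\delta*u)$. Existence and uniqueness of $\rho_\delta$ for small $\delta$ is a result of the paper. *)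

(* Defs.v *)
From Stdlib Require Import Reals.
From Coquelicot Require Import Coquelicot.
Open Scope R_scope.

(* Free heat kernel of d/dt = (1/2) d^2/dx^2: G_t(x) = exp(-x^2/(2t)) / sqrt(2 pi t). *)
Definition heat_kernel (t x : R) : R := exp (- (x ^ 2) / (2 * t)) / sqrt (2 * PI * t).

(* The images of r' under repeated reflections of [0,1] (across 0 and 1)
   are the points 2k + r' and 2k - r', k in Z.  We group the terms by |k| = n. *)
Definition neum_term (t r r' : R) (n : nat) : R :=
  match n with
  | O => heat_kernel t (r - r') + heat_kernel t (r + r')
  | S _ => heat_kernel t (r - r' - 2 * INR n) + heat_kernel t (r - r' + 2 * INR n)
         + heat_kernel t (r + r' - 2 * INR n) + heat_kernel t (r + r' + 2 * INR n)
  end.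

Definition G_neum (t r r' : R) : R := Series (neum_term t r r').

(* (G^neum_delta * u)(r) for u = c D_0 + rho. *)
Definition conv_neum (delta c : R) (rho : R -> R) (r : R) : R :=
  c * G_neum delta r 0 + RInt (fun r' => G_neum delta r r' * rho r') 0 1.

Definition admissible (Rc : R) (rho : R -> R) : Prop :=
  (forall x, 0 <= x <= Rc ->
     filterlim rho (within (fun y => 0 <= y <= Rc) (locally x)) (locally (rho x)))
  /\ (forall x, Rc < x <= 1 -> rho x = 0).

(* u = j delta D_0 + rho is a fixed point of S^{(delta,-)}_delta = K^{(delta)}(G^neum_delta * .)
   with cut point R^{(delta)}_{G^neum_delta * u} = Rc:
   - the cut point of v := G^neum_delta * u is Rc, i.e. int_Rc^1 v = j delta;
   - K^{(delta)} v = j delta D_0 + 1_{[0,Rc]} v equals u, i.e. rho = v on [0,Rc]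
     (and rho = 0 on (Rc,1], which is part of [admissible]). *)
Definition fixed_point_with_cut (j Rc delta : R) (rho : R -> R) : Prop :=
  RInt (conv_neum delta (j * delta) rho) Rc 1 = j * delta
  /\ (forall r, 0 <= r <= Rc -> rho r = conv_neum delta (j * delta) rho r).

(* Main.v *)
Require Import Defs.
From Stdlib Require Import Reals Lra Lia Psatz.
From Coquelicot Require Import Coquelicot.
Open Scope R_scope.

(** On [0,R] the fixed point satisfies [rho = f + T rho], where [T] is the Neumann kernel
    restricted to [0,R] and [f = j delta G_neum(.,0)]; [rho] is squeezed between a sub- and a
    supersolution.  Up to errors [O(delta^2)] the kernel is the line heat kernel acting on even
    functions, and the finite-time discrete potential kernel
    [a(x) = delta * sum_(1 <= n <= N) (G_(n delta)(0) - G_(n delta)(x))] satisfies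
    [G_delta * a = a + delta G_delta - delta G_((N+1) delta)] by the semigroup law.
    Hence [2 j (a(R) - a)], which is nonpositive outside [-R,R], is a subsolution, and
    [2 j (a(R+e) - a) + (j+1) e ((R+e)^2 - x^2)] is a supersolution once [N delta >= 1/e^2]:
    the parabola gains [(j+1) e delta] and absorbs all the errors.  Finally [a(x)] is a Riemann
    sum of the decreasing function [s |-> G_s(0) - G_s(x)], whose integral over [(0,oo)] is
    [|x|]. *)

(** * The Gaussian integral *)

(** One heat step moves a smooth profile by only [O(delta)], so an error made at every step is
    amplified by about [1 / delta]. For a fixed [e] the parabola buys a gain proportional to [delta]
    per step; hence the insistence on errors [O(delta^2)], and the polynomial bounds on Gaussian
    tails that supply these powers. The second obstacle is the cut: in discrete time the profile
    does not vanish at R, but has a boundary layer there on the scale [sqrt delta] of one jump. Its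
    shape is never analysed. Caps vanishing at R and at R+e enclose it, with [e] fixed while [delta]
    tends to 0 and sent to 0 only at the end. The two caps are not treated alike. For the
    subsolution every discrepancy between the killed kernel and the line kernel has the favourable
    sign. The supersolution stays nonnegative up to distance [e] beyond the cut, so its negative
    part is reached only by jumps longer than [e], whose weight is exponentially small in
    [e^2 / delta]. Stopping the potential at a finite N avoids infinite sums; the price is a
    residual of order [e delta], paid by the parabola as well. *)

Lemma exp_le_compat (x y : R) : x <= y -> exp x <= exp y.
Proof. intros [H | ->]; [left; now apply exp_increasing | apply Rle_refl]. Qed.

(** The cube of [u / 3 <= exp (u / 3)]. With [u] of order [1 / d], the third power still leaves
    [d ^ 2] after division by the normalising factor of the kernel. *)
Lemma exp_neg_le_cube (u : R) : 0 < u -> exp (- u) <= 27 / u ^ 3.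
Proof.
  intros Hu.
  assert (H : u ^ 3 / 27 <= exp u).
  { replace u with (u / 3 + (u / 3 + u / 3)) at 2 by field.
    rewrite !exp_plus.
    assert (H3 : u / 3 <= exp (u / 3)) by (pose proof (exp_ineq1_le (u / 3)); lra).
    assert (H9 : u / 3 * (u / 3) <= exp (u / 3) * exp (u / 3))
      by (apply Rmult_le_compat; lra).
    replace (u ^ 3 / 27) with (u / 3 * (u / 3 * (u / 3))) by field.
    apply Rmult_le_compat; try lra; nra. }
  assert (Hu3 : 0 < u ^ 3) by (apply pow_lt; lra).
  rewrite exp_Ropp. replace (27 / u ^ 3) with (/ (u ^ 3 / 27)) by (field; lra).
  apply Rinv_le_contravar; lra.
Qed.

Lemma continuous_of_derive (f : R -> R) (df : R) (x : R) : is_derive f x df -> continuous f x.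
Proof. intros H; apply (ex_derive_continuous f x); now exists df. Qed.

Definition gauss (z : R) : R := exp (- z ^ 2 / 2).

Lemma continuous_gauss (z : R) : continuous gauss z.
Proof.
  apply (ex_derive_continuous gauss z). unfold gauss. auto_derive. easy.
Qed.

Lemma ex_RInt_gauss (a b : R) : ex_RInt gauss a b.
Proof. apply (ex_RInt_continuous (V := R_CompleteNormedModule)); intros; apply continuous_gauss. Qed.

Definition gauss_int (z : R) : R := RInt gauss 0 z.

Lemma is_derive_gauss_int (z : R) : is_derive gauss_int z (gauss z).
Proof.
  apply (is_derive_RInt gauss gauss_int 0 z).
  - apply filter_forall; intros y; apply (RInt_correct gauss 0 y), ex_RInt_gauss.
  - apply continuous_gauss.
Qed.

(** The auxiliary function of the classical evaluation by differentiation under the integral sign: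
    its derivative is minus half that of [gauss_int ^ 2]. *)
Definition gauss_aux (x : R) : R :=
  RInt (fun t => exp (- (x ^ 2 * (1 + t ^ 2)) / 2) / (1 + t ^ 2)) 0 1.

Lemma gauss_aux_integrand_derive (x t : R) :
  is_derive (fun u => exp (- (u ^ 2 * (1 + t ^ 2)) / 2) / (1 + t ^ 2)) x
    (- x * exp (- (x ^ 2 * (1 + t ^ 2)) / 2)).
Proof.
  assert (0 < 1 + t ^ 2) by nra. simpl in H.
  auto_derive. easy. simpl. unfold Rdiv. field. nra.
Qed.

Lemma ex_RInt_gauss_aux (x a b : R) :
  ex_RInt (fun t => exp (- (x ^ 2 * (1 + t ^ 2)) / 2) / (1 + t ^ 2)) a b.
Proof.
  apply (ex_RInt_continuous (V := R_CompleteNormedModule)); intros t _.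
  apply (ex_derive_continuous (fun t => exp (- (x ^ 2 * (1 + t ^ 2)) / 2) / (1 + t ^ 2))).
  auto_derive. nra.
Qed.

Lemma is_derive_gauss_aux (x : R) : is_derive gauss_aux x (- gauss x * gauss_int x).
Proof.
  evar_last.
  - apply (is_derive_RInt_param
      (fun x t => exp (- (x ^ 2 * (1 + t ^ 2)) / 2) / (1 + t ^ 2)) 0 1 x).
    + apply filter_forall; intros y t _.
      exists (- y * exp (- (y ^ 2 * (1 + t ^ 2)) / 2)).
      apply gauss_aux_integrand_derive.
    + intros t _.
      apply continuity_2d_pt_ext with (fun u v => - u * exp (- (u ^ 2 * (1 + v ^ 2)) / 2)).
      * intros u v; symmetry; apply is_derive_unique, gauss_aux_integrand_derive.
      * apply continuity_2d_pt_filterlim.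
        assert (Hu : continuous (fun p : R * R => fst p) (x, t)) by apply continuous_fst.
        assert (Hv : continuous (fun p : R * R => snd p) (x, t)) by apply continuous_snd.
        change (continuous (fun p : R * R =>
          mult (- fst p) (exp (- (fst p ^ 2 * (1 + snd p ^ 2)) / 2))) (x, t)).
        apply @continuous_mult.
        { apply (continuous_opp (fun p : R * R => fst p)), Hu. }
        apply (continuous_comp (fun p : R * R => - (fst p ^ 2 * (1 + snd p ^ 2)) / 2) exp).
        2: apply continuous_exp.
        apply continuous_ext with (fun p : R * R =>
          mult (mult (mult (fst p) (fst p)) (plus 1 (mult (snd p) (snd p)))) (- / 2)).
        { intros p; unfold mult, plus; simpl; field. }
        apply @continuous_mult; [ | apply continuous_const].
        apply @continuous_mult; [now apply @continuous_mult | ].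
        apply @continuous_plus; [apply continuous_const | now apply @continuous_mult].
    + apply filter_forall; intros y; apply ex_RInt_gauss_aux.
  - apply is_RInt_unique.
    (* The denominator [1 + t ^ 2] has cancelled and the exponential splits as
       [gauss x * gauss (x * t)]; the substitution [x * t] then produces [gauss_int x]. *)
    apply is_RInt_ext with (fun t => scal (- gauss x) (scal x (gauss (x * t + 0)))).
    + intros t _. transitivity (- x * exp (- (x ^ 2 * (1 + t ^ 2)) / 2)).
      2: { symmetry. apply is_derive_unique, gauss_aux_integrand_derive. }
      unfold scal; simpl; unfold mult; simpl; unfold gauss.
      replace (- (x * (x * 1) * (1 + t * (t * 1))) / 2)
        with (- (x ^ 2) / 2 + - ((x * t + 0) ^ 2) / 2) by field.
      rewrite exp_plus. ring.
    + apply (is_RInt_scal (V := R_NormedModule)).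
      apply (is_RInt_comp_lin gauss x 0 0 1).
      replace (x * 0 + 0) with 0 by ring; replace (x * 1 + 0) with x by ring.
      apply (RInt_correct gauss 0 x), ex_RInt_gauss.
Qed.

(* Polar coordinates in disguise: [gauss_int ^ 2 + 2 * gauss_aux] has zero derivative. *)
Lemma gauss_int_sqr (x : R) : gauss_int x ^ 2 + 2 * gauss_aux x = PI / 2.
Proof.
  set (F := fun x => gauss_int x ^ 2 + 2 * gauss_aux x).
  assert (HF : forall y, is_derive F y 0).
  { intros y. unfold F. evar_last.
    - apply (is_derive_plus (fun x => gauss_int x ^ 2) (fun x => 2 * gauss_aux x)).
      + apply (is_derive_pow gauss_int 2 y _ (is_derive_gauss_int y)).
      + apply (is_derive_scal gauss_aux y 2 _ (is_derive_gauss_aux y)).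
    - unfold plus, scal; simpl; unfold mult; simpl. ring. }
  assert (H0 : F 0 = PI / 2).
  { unfold F, gauss_int, gauss_aux. rewrite RInt_point.
    rewrite (RInt_ext _ (fun t => / (1 + t ^ 2))).
    - assert (H : is_RInt (fun t => / (1 + t ^ 2)) 0 1 (atan 1 - atan 0)).
      { apply (is_RInt_derive atan (fun t => / (1 + t ^ 2))).
        - intros t _. apply is_derive_Reals.
          apply derivable_pt_lim_atan.
        - intros t _. apply (ex_derive_continuous (fun t => / (1 + t ^ 2))).
          auto_derive. nra. }
      rewrite (is_RInt_unique _ _ _ _ H), atan_1, atan_0. change (0 ^ 2 + 2 * (PI / 4 - 0) = PI / 2). field.
    - intros t _. replace (- (0 ^ 2 * (1 + t ^ 2)) / 2) with 0 by (simpl; field).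
      rewrite exp_0. apply Rmult_1_l. }
  fold (F x). rewrite <- H0.
  destruct (MVT_gen F 0 x (fun _ => 0)) as [c [_ Hc]].
  - intros; apply HF.
  - intros y _. apply continuity_pt_filterlim, (continuous_of_derive F 0), HF.
  - lra.
Qed.

Lemma gauss_aux_bounds (x : R) : 0 <= gauss_aux x <= gauss x.
Proof.
  unfold gauss_aux. split.
  - apply RInt_ge_0; [lra | apply ex_RInt_gauss_aux | ].
    intros t _. assert (0 < 1 + t ^ 2) by nra.
    apply Rlt_le, Rdiv_lt_0_compat; [apply exp_pos | easy].
  - replace (gauss x) with (RInt (fun _ => gauss x) 0 1)
      by (rewrite RInt_const; unfold scal; simpl; unfold mult; simpl; ring).
    apply RInt_le; [lra | apply ex_RInt_gauss_aux | apply ex_RInt_const | ].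
    intros t _. assert (1 <= 1 + t ^ 2) by nra.
    unfold gauss.
    assert (He : exp (- (x ^ 2 * (1 + t ^ 2)) / 2) <= exp (- x ^ 2 / 2)).
    { apply exp_le_compat. assert (0 <= x ^ 2 * t ^ 2) by (rewrite <- Rpow_mult_distr; nra). lra. }
    pose proof (exp_pos (- (x ^ 2 * (1 + t ^ 2)) / 2)).
    apply Rle_trans with (2 := He). apply Rmult_le_reg_r with (1 + t ^ 2); [lra | ].
    unfold Rdiv at 1. rewrite Rmult_assoc, Rinv_l by lra. nra.
Qed.

Lemma is_lim_gauss : is_lim gauss p_infty 0.
Proof.
  apply is_lim_le_le_loc with (fun _ => 0) (fun z => exp (- z)).
  - exists 2; intros z Hz; unfold gauss; split; [left; apply exp_pos | apply exp_le_compat; nra].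
  - apply is_lim_const.
  - apply (is_lim_comp exp Ropp p_infty 0 m_infty).
    + apply is_lim_exp_m.
    + apply (is_lim_opp (fun x => x) p_infty p_infty), is_lim_id.
    + now exists 0.
Qed.

Lemma gauss_int_nonneg (z : R) : 0 <= z -> 0 <= gauss_int z.
Proof.
  intros Hz; apply RInt_ge_0; [easy | apply ex_RInt_gauss | intros; left; apply exp_pos].
Qed.

Lemma is_lim_gauss_int : is_lim gauss_int p_infty (sqrt (PI / 2)).
Proof.
  apply is_lim_ext_loc with (fun x => sqrt (PI / 2 - 2 * gauss_aux x)).
  - exists 0; intros x Hx. rewrite <- (gauss_int_sqr x).
    replace (gauss_int x ^ 2 + 2 * gauss_aux x - 2 * gauss_aux x) with (gauss_int x ^ 2) by ring.
    apply sqrt_pow2, gauss_int_nonneg; lra.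
  - apply (is_lim_comp_continuous (fun x => PI / 2 - 2 * gauss_aux x) sqrt).
    + replace (Finite (PI / 2)) with (Finite (PI / 2 - 2 * 0))
        by (f_equal; ring).
      apply is_lim_minus'; [apply is_lim_const | ].
      apply (is_lim_scal_l gauss_aux 2 p_infty 0).
      apply is_lim_le_le_loc with (fun _ => 0) gauss.
      * exists 0; intros; apply gauss_aux_bounds.
      * apply is_lim_const.
      * apply is_lim_gauss.
    + apply continuity_pt_filterlim, continuity_pt_sqrt. pose proof PI_RGT_0; lra.
Qed.

(** * Heat convolution on the line *)

Lemma gauss_int_opp (z : R) : gauss_int (- z) = - gauss_int z.
Proof.
  set (F := fun z => gauss_int (- z) + gauss_int z).
  assert (HF : forall y, is_derive F y 0).
  { intros y. unfold F. evar_last.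
    - apply (is_derive_plus (fun z => gauss_int (- z)) gauss_int).
      + apply (is_derive_comp gauss_int Ropp y (gauss (- y)) (-1)).
        * apply is_derive_gauss_int.
        * auto_derive; [easy | ring].
      + apply is_derive_gauss_int.
    - unfold plus, scal; simpl; unfold mult; simpl; unfold gauss.
      replace ((- y) ^ 2) with (y ^ 2) by ring. ring. }
  destruct (MVT_gen F 0 z (fun _ => 0)) as [c [_ Hc]].
  - intros; apply HF.
  - intros y _. apply continuity_pt_filterlim, (continuous_of_derive F 0), HF.
  - assert (H0 : gauss_int 0 = 0) by (unfold gauss_int; apply (RInt_point 0 gauss)).
    unfold F in Hc. rewrite Ropp_0, H0 in Hc. lra.
Qed.

Lemma sqrt_2PI_pos : 0 < sqrt (2 * PI).
Proof. apply sqrt_lt_R0. pose proof PI_RGT_0; lra. Qed.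

Lemma sqrt_2PI_ge_2 : 2 <= sqrt (2 * PI).
Proof.
  rewrite <- (sqrt_pow2 2) at 1 by lra. apply sqrt_le_1_alt.
  pose proof PI2_3_2. lra.
Qed.

Lemma sqrt_half_PI : sqrt (PI / 2) = sqrt (2 * PI) / 2.
Proof.
  pose proof PI_RGT_0.
  replace (PI / 2) with (2 * PI / (2 ^ 2)) by field.
  rewrite sqrt_div by lra. rewrite sqrt_pow2 by lra. easy.
Qed.

Lemma heat_kernel_pos (t x : R) : 0 < t -> 0 < heat_kernel t x.
Proof.
  intros Ht. apply Rdiv_lt_0_compat; [apply exp_pos | apply sqrt_lt_R0].
  pose proof PI_RGT_0; nra.
Qed.

Lemma heat_kernel_opp (t x : R) : heat_kernel t (- x) = heat_kernel t x.
Proof. unfold heat_kernel. now replace ((- x) ^ 2) with (x ^ 2) by ring. Qed.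

Lemma heat_kernel_gauss (t x : R) : 0 < t ->
  heat_kernel t x = gauss (x / sqrt t) / (sqrt (2 * PI) * sqrt t).
Proof.
  intros Ht. pose proof PI_RGT_0. pose proof (sqrt_lt_R0 t Ht) as Hs.
  unfold heat_kernel, gauss. rewrite sqrt_mult by lra. do 2 f_equal.
  replace ((x / sqrt t) ^ 2) with (x ^ 2 / (sqrt t ^ 2)) by (field; lra).
  rewrite pow2_sqrt by lra. field; lra.
Qed.

Lemma heat_kernel_antitone (t x y : R) : 0 < t -> x ^ 2 <= y ^ 2 ->
  heat_kernel t y <= heat_kernel t x.
Proof.
  intros Ht Hxy. unfold heat_kernel. apply Rmult_le_compat_r.
  - left. apply Rinv_0_lt_compat, sqrt_lt_R0. pose proof PI_RGT_0; nra.
  - apply exp_le_compat. unfold Rdiv. apply Rmult_le_compat_r.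
    + left; apply Rinv_0_lt_compat; lra.
    + lra.
Qed.

Lemma heat_kernel_le_inv_sqrt (t x : R) : 0 < t -> heat_kernel t x <= / (2 * sqrt t).
Proof.
  intros Ht. rewrite heat_kernel_gauss by easy.
  pose proof (sqrt_lt_R0 t Ht). pose proof sqrt_2PI_ge_2.
  apply Rle_trans with (1 / (sqrt (2 * PI) * sqrt t)).
  - apply Rmult_le_compat_r; [left; apply Rinv_0_lt_compat; nra | ].
    unfold gauss. rewrite <- exp_0. apply exp_le_compat.
    pose proof (pow2_ge_0 (x / sqrt t)). lra.
  - rewrite Rdiv_1_l. apply Rinv_le_contravar; nra.
Qed.

Lemma is_derive_heat_kernel (t m y : R) : 0 < t ->
  is_derive (fun y => heat_kernel t (m - y)) y ((m - y) / t * heat_kernel t (m - y)).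
Proof.
  intros Ht. unfold heat_kernel.
  assert (0 < sqrt (2 * PI * t)) by (apply sqrt_lt_R0; pose proof PI_RGT_0; nra).
  set (c := sqrt (2 * PI * t)) in *.
  auto_derive; [easy | ].
  change (- ((m + - y) * ((m + - y) * 1))) with (- (m - y) ^ 2).
  unfold Rdiv. field. lra.
Qed.

Lemma continuous_heat_kernel (t m y : R) : 0 < t ->
  continuous (fun y => heat_kernel t (m - y)) y.
Proof. intros Ht. eapply continuous_of_derive, is_derive_heat_kernel, Ht. Qed.

Lemma continuous_heat_kernel_id (t y : R) : 0 < t -> continuous (heat_kernel t) y.
Proof.
  intros Ht. apply continuous_ext with (fun y => heat_kernel t (0 - y)).
  - intros x. rewrite <- heat_kernel_opp. f_equal. ring.
  - now apply continuous_heat_kernel.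
Qed.

(** The Gaussian distribution function minus 1/2: integrating from the mean makes it odd about [m],
    with limits 1/2 and -1/2. *)
Definition heat_cdf (t m y : R) : R := gauss_int ((y - m) / sqrt t) / sqrt (2 * PI).

Lemma is_derive_heat_cdf (t m y : R) : 0 < t ->
  is_derive (heat_cdf t m) y (heat_kernel t (m - y)).
Proof.
  intros Ht. pose proof (sqrt_lt_R0 t Ht). pose proof sqrt_2PI_pos.
  unfold heat_cdf. evar_last.
  - apply (is_derive_ext (fun y => / sqrt (2 * PI) * gauss_int ((y - m) / sqrt t))).
    { intros; apply Rmult_comm. }
    apply (is_derive_scal (fun y => gauss_int ((y - m) / sqrt t))).
    apply (is_derive_comp gauss_int (fun y => (y - m) / sqrt t)).
    + apply is_derive_gauss_int.
    + instantiate (1 := / sqrt t). auto_derive; [easy | field; lra].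
  - unfold scal; simpl; unfold mult; simpl. rewrite <- heat_kernel_opp.
    rewrite heat_kernel_gauss by easy. replace (- (m - y)) with (y - m) by ring.
    field. lra.
Qed.

Lemma is_lim_affine_p (a b : R) : 0 < a -> is_lim (fun y => (y - b) / a) p_infty p_infty.
Proof.
  intros Ha P [M HM]. exists (M * a + b). intros y Hy. apply HM.
  apply Rmult_lt_reg_r with a; [easy | ]. unfold Rdiv.
  rewrite Rmult_assoc, Rinv_l by lra. lra.
Qed.

Lemma is_lim_heat_cdf_p (t m : R) : 0 < t -> is_lim (heat_cdf t m) p_infty (/ 2).
Proof.
  intros Ht. pose proof (sqrt_lt_R0 t Ht). pose proof sqrt_2PI_pos.
  apply is_lim_ext with (fun y => / sqrt (2 * PI) * gauss_int ((y - m) / sqrt t)).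
  { intros; unfold heat_cdf, Rdiv; ring. }
  replace (Finite (/ 2)) with (Rbar_mult (/ sqrt (2 * PI)) (sqrt (PI / 2))).
  2: { simpl. f_equal. rewrite sqrt_half_PI. field. lra. }
  apply is_lim_scal_l.
  apply (is_lim_comp gauss_int _ p_infty (sqrt (PI / 2)) p_infty).
  - apply is_lim_gauss_int.
  - now apply is_lim_affine_p.
  - now exists 0.
Qed.

Lemma is_lim_heat_cdf_m (t m : R) : 0 < t ->
  is_lim (fun L => heat_cdf t m (- L)) p_infty (- / 2).
Proof.
  intros Ht.
  apply is_lim_ext with (fun L => - heat_cdf t (- m) L).
  - intros L. unfold heat_cdf.
    replace ((- L - m) / sqrt t) with (- ((L - - m) / sqrt t)) by (unfold Rdiv; ring).
    rewrite gauss_int_opp. unfold Rdiv; ring.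
  - apply (is_lim_opp (heat_cdf t (- m)) p_infty (/ 2)). now apply is_lim_heat_cdf_p.
Qed.

(** A relation rather than a function, so that a value comes with the convergence of its integral.
    Symmetric truncation is what folds onto the half line for even functions. *)
Definition line_conv (t : R) (h : R -> R) (r v : R) : Prop :=
  is_lim (fun L => RInt (fun y => heat_kernel t (r - y) * h y) (- L) L) p_infty v.

Lemma continuous_heat_kernel_mult (t r : R) (h : R -> R) (y : R) : 0 < t ->
  continuous h y -> continuous (fun y => heat_kernel t (r - y) * h y) y.
Proof.
  intros Ht Hh. apply (continuous_mult (fun y => heat_kernel t (r - y)) h y).
  - now apply continuous_heat_kernel.
  - easy.
Qed.

Lemma ex_RInt_heat_kernel_mult (t r : R) (h : R -> R) (a b : R) : 0 < t ->
  (forall y, continuous h y) -> ex_RInt (fun y => heat_kernel t (r - y) * h y) a b.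
Proof.
  intros Ht Hh. apply (ex_RInt_continuous (V := R_CompleteNormedModule)); intros y _.
  now apply continuous_heat_kernel_mult.
Qed.

Lemma line_conv_lin (t : R) (h1 h2 : R -> R) (r v1 v2 a b : R) : 0 < t ->
  (forall y, continuous h1 y) -> (forall y, continuous h2 y) ->
  line_conv t h1 r v1 -> line_conv t h2 r v2 ->
  line_conv t (fun y => a * h1 y + b * h2 y) r (a * v1 + b * v2).
Proof.
  intros Ht C1 C2 H1 H2.
  apply is_lim_ext with (fun L =>
    a * RInt (fun y => heat_kernel t (r - y) * h1 y) (- L) L +
    b * RInt (fun y => heat_kernel t (r - y) * h2 y) (- L) L).
  - intros L. symmetry. apply is_RInt_unique.
    apply is_RInt_ext with (fun y =>
      plus (scal a (heat_kernel t (r - y) * h1 y)) (scal b (heat_kernel t (r - y) * h2 y))).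
    { intros y _; unfold plus, scal; simpl; unfold mult; simpl; ring. }
    apply (is_RInt_plus (V := R_NormedModule)); apply (is_RInt_scal (V := R_NormedModule)).
    + apply (RInt_correct (fun y => heat_kernel t (r - y) * h1 y)).
      now apply ex_RInt_heat_kernel_mult.
    + apply (RInt_correct (fun y => heat_kernel t (r - y) * h2 y)).
      now apply ex_RInt_heat_kernel_mult.
  - apply is_lim_plus'.
    + apply (is_lim_scal_l _ a p_infty v1 H1).
    + apply (is_lim_scal_l _ b p_infty v2 H2).
Qed.

Lemma line_conv_antiderivative (t : R) (h F : R -> R) (r l1 l2 : R) : 0 < t ->
  (forall y, continuous h y) ->
  (forall y, is_derive F y (heat_kernel t (r - y) * h y)) ->
  is_lim F p_infty l1 -> is_lim (fun L => F (- L)) p_infty l2 ->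
  line_conv t h r (l1 - l2).
Proof.
  intros Ht Ch HF H1 H2.
  apply is_lim_ext with (fun L => F L - F (- L)).
  - intros L. symmetry. apply is_RInt_unique.
    apply (is_RInt_derive F (fun y => heat_kernel t (r - y) * h y)).
    + intros; apply HF.
    + intros; now apply continuous_heat_kernel_mult.
  - now apply is_lim_minus'.
Qed.

Lemma line_conv_one (t r : R) : 0 < t -> line_conv t (fun _ => 1) r 1.
Proof.
  intros Ht.
  replace (line_conv t (fun _ => 1) r 1) with (line_conv t (fun _ => 1) r (/ 2 - - / 2))
    by (f_equal; field).
  apply line_conv_antiderivative with (heat_cdf t r); try easy.
  - intros; apply continuous_const.
  - intros y. rewrite Rmult_1_r. now apply is_derive_heat_cdf.
  - now apply is_lim_heat_cdf_p.
  - now apply is_lim_heat_cdf_m.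
Qed.

(** Completing the square: in [y] the product is a Gaussian of mean [r * s / (s + t)] and variance
    [s * t / (s + t)]. The semigroup law then reduces to the total mass of one Gaussian. *)
Lemma heat_kernel_mult (s t r y : R) : 0 < s -> 0 < t ->
  heat_kernel t (r - y) * heat_kernel s y =
  heat_kernel (s + t) r * heat_kernel (s * t / (s + t)) (r * s / (s + t) - y).
Proof.
  intros Hs Ht. pose proof PI_RGT_0.
  assert (Hst : 0 < s * t / (s + t)) by (apply Rdiv_lt_0_compat; nra).
  unfold heat_kernel, Rdiv at 1 3 5 7.
  match goal with |- exp ?a * / ?p * (exp ?b * / ?q) = exp ?c * / ?p' * (exp ?d * / ?q') =>
    transitivity (exp (a + b) * / (p * q)); [ | transitivity (exp (c + d) * / (p' * q'))] end.
  - rewrite exp_plus, Rinv_mult. ring.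
  - f_equal.
    + f_equal. field. lra.
    + f_equal. rewrite <- !sqrt_mult_alt by nra. f_equal. field. lra.
  - rewrite exp_plus, Rinv_mult. ring.
Qed.

Lemma line_conv_heat_kernel (s t r : R) : 0 < s -> 0 < t ->
  line_conv t (heat_kernel s) r (heat_kernel (s + t) r).
Proof.
  intros Hs Ht.
  assert (Hst : 0 < s * t / (s + t)) by (apply Rdiv_lt_0_compat; nra).
  set (k := heat_kernel (s + t) r).
  replace k with (k * / 2 - k * - / 2) by field.
  apply line_conv_antiderivative with (fun y => k * heat_cdf (s * t / (s + t)) (r * s / (s + t)) y);
    try easy.
  - intros; now apply continuous_heat_kernel_id.
  - intros y. rewrite heat_kernel_mult by easy. apply (is_derive_scal (heat_cdf _ _)).
    now apply is_derive_heat_cdf.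
  - apply (is_lim_scal_l (heat_cdf _ _) k p_infty (/ 2)). now apply is_lim_heat_cdf_p.
  - apply (is_lim_scal_l (fun L => heat_cdf _ _ (- L)) k p_infty (- / 2)).
    now apply is_lim_heat_cdf_m.
Qed.

Lemma is_lim_shift_mult_heat_kernel (t a b : R) : 0 < t ->
  is_lim (fun y => (y + a) * heat_kernel t (b - y)) p_infty 0.
Proof.
  intros Ht. pose proof (sqrt_lt_R0 t Ht) as Hst.
  (* [216 = 27 * 2 ^ 3] comes from the cubic bound at [x ^ 2 / (2 * t)]. The resulting decay
     [x ^ (-6)] is weakened to [x ^ (-2)], enough against a linear factor. *)
  set (C := 216 * t ^ 3 / (2 * sqrt t)).
  assert (HC : 0 < C).
  { apply Rdiv_lt_0_compat; [ | lra]. apply Rmult_lt_0_compat; [lra | now apply pow_lt]. }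
  assert (Hb : forall x, 1 < x -> heat_kernel t x <= C / x ^ 2).
  { intros x Hx. rewrite heat_kernel_gauss by easy.
    assert (Hg : gauss (x / sqrt t) <= 216 * t ^ 3 / x ^ 2).
    { unfold gauss. replace (- (x / sqrt t) ^ 2 / 2) with (- (x ^ 2 / (2 * t))).
      2: { replace ((x / sqrt t) ^ 2) with (x ^ 2 / (sqrt t ^ 2)) by (field; lra).
           rewrite pow2_sqrt by lra. field; lra. }
      eapply Rle_trans; [apply exp_neg_le_cube; apply Rdiv_lt_0_compat; nra | ].
      replace (27 / (x ^ 2 / (2 * t)) ^ 3) with (216 * t ^ 3 / (x ^ 6)) by (field; lra).
      apply Rmult_le_compat_l.
      - apply Rlt_le, Rmult_lt_0_compat; [lra | now apply pow_lt].
      - apply Rinv_le_contravar; [nra | ]. apply Rle_pow; [lra | lia]. }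
    replace (C / x ^ 2) with ((216 * t ^ 3 / x ^ 2) * / (2 * sqrt t)) by (unfold C; field; lra).
    pose proof sqrt_2PI_ge_2.
    apply Rmult_le_compat; [left; apply exp_pos | left; apply Rinv_0_lt_compat; nra | easy | ].
    apply Rinv_le_contravar; nra. }
  apply is_lim_le_le_loc with (fun _ => 0)
    (fun y => C * (1 + Rabs (a + b)) * / ((y - b) / 1)).
  - exists (Rmax (- a) (b + 1)). intros y Hy.
    pose proof (Rmax_l (- a) (b + 1)). pose proof (Rmax_r (- a) (b + 1)).
    assert (Hx : 1 < y - b) by lra. specialize (Hb _ Hx).
    rewrite <- heat_kernel_opp. replace (- (b - y)) with (y - b) by ring.
    pose proof (heat_kernel_pos t (y - b) Ht) as Hp.
    set (x := y - b) in *. split; [nra | ].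
    assert (Hya : y + a <= (1 + Rabs (a + b)) * x).
    { pose proof (Rle_abs (a + b)). pose proof (Rabs_pos (a + b)).
      replace (y + a) with (x + (a + b)) by (unfold x; ring). nra. }
    apply Rle_trans with ((1 + Rabs (a + b)) * x * (C / x ^ 2)).
    + apply Rmult_le_compat; lra.
    + right; field; lra.
  - apply is_lim_const.
  - replace (Finite 0) with (Rbar_mult (C * (1 + Rabs (a + b))) 0) by (simpl; f_equal; ring).
    apply is_lim_scal_l.
    apply (is_lim_inv (fun y => (y - b) / 1) p_infty p_infty); [ | easy].
    apply is_lim_affine_p; lra.
Qed.

Lemma continuous_sqr (y : R) : continuous (fun y => y ^ 2) y.
Proof. apply (ex_derive_continuous (fun y => y ^ 2)). auto_derive. easy. Qed.

(** Write [y ^ 2 - r ^ 2 = (y + r) * (y - r)]; the kernel times [y - r] is [- t] times its own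
    derivative in [y], so one integration by parts gives the antiderivative used. *)
Lemma line_conv_sqr (t r : R) : 0 < t -> line_conv t (fun y => y ^ 2) r (r ^ 2 + t).
Proof.
  intros Ht.
  replace (r ^ 2 + t) with (((r ^ 2 + t) * / 2 - t * 0) - ((r ^ 2 + t) * - / 2 - t * 0)) by field.
  apply line_conv_antiderivative with
    (fun y => (r ^ 2 + t) * heat_cdf t r y - t * ((y + r) * heat_kernel t (r - y))); try easy.
  - apply continuous_sqr.
  - intros y. evar_last.
    + apply (is_derive_minus (fun y => (r ^ 2 + t) * heat_cdf t r y)
        (fun y => t * ((y + r) * heat_kernel t (r - y)))).
      * apply (is_derive_scal (heat_cdf t r)). now apply is_derive_heat_cdf.
      * apply (is_derive_scal (fun y => (y + r) * heat_kernel t (r - y))).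
        apply (is_derive_mult (fun y => y + r) (fun y => heat_kernel t (r - y))).
        { instantiate (1 := 1). auto_derive; easy. }
        { now apply is_derive_heat_kernel. }
        intros; apply Rmult_comm.
    + unfold minus, plus, opp, mult; simpl. field. lra.
  - apply is_lim_minus'.
    + apply (is_lim_scal_l (heat_cdf t r) (r ^ 2 + t) p_infty (/ 2)).
      now apply is_lim_heat_cdf_p.
    + apply (is_lim_scal_l (fun y => (y + r) * heat_kernel t (r - y)) t p_infty 0).
      now apply is_lim_shift_mult_heat_kernel.
  - apply is_lim_minus'.
    + apply (is_lim_scal_l (fun L => heat_cdf t r (- L)) (r ^ 2 + t) p_infty (- / 2)).
      now apply is_lim_heat_cdf_m.
    + apply (is_lim_scal_l (fun L => (- L + r) * heat_kernel t (r - - L)) t p_infty 0).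
      apply is_lim_ext with (fun L => - ((L + - r) * heat_kernel t (- r - L))).
      * intros L. rewrite <- (heat_kernel_opp _ (r - - L)).
        replace (- (r - - L)) with (- r - L) by ring. ring.
      * replace (Finite 0) with (Rbar_opp 0) by (simpl; f_equal; ring).
        apply is_lim_opp. now apply is_lim_shift_mult_heat_kernel.
Qed.

(** * The discrete potential kernel *)

(** In dimension one the values [heat_kernel (n * d) x] are not summable over [n]; the drop from the
    origin is of order [s ^ (-3/2)] for large [s], so the potential stays bounded in N. *)
Definition heat_drop (s x : R) : R := heat_kernel s 0 - heat_kernel s x.

Fixpoint potential (d : R) (N : nat) (x : R) : R :=
  match N with
  | O => 0
  | S n => potential d n x + d * heat_drop (INR (S n) * d) x
  end.

Lemma INR_S_mult_pos (n : nat) (d : R) : 0 < d -> 0 < INR (S n) * d.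
Proof. intros Hd. apply Rmult_lt_0_compat; [apply lt_0_INR; lia | easy]. Qed.

Lemma potential_opp (d : R) (N : nat) (x : R) : potential d N (- x) = potential d N x.
Proof.
  induction N as [ | n IH]; [easy | ].
  simpl potential. unfold heat_drop. now rewrite IH, heat_kernel_opp.
Qed.

Lemma continuous_potential (d : R) (N : nat) (x : R) : 0 < d -> continuous (potential d N) x.
Proof.
  intros Hd. induction N as [ | n IH]; [apply continuous_const | ].
  apply (continuous_plus (potential d n) (fun x => d * heat_drop (INR (S n) * d) x)); [easy | ].
  apply (continuous_mult (fun _ => d) (heat_drop (INR (S n) * d))); [apply continuous_const | ].
  apply (continuous_minus (fun _ => heat_kernel (INR (S n) * d) 0) (heat_kernel (INR (S n) * d))).
  - apply continuous_const.
  - apply continuous_heat_kernel_id, INR_S_mult_pos, Hd.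
Qed.

Lemma potential_mono (d : R) (N : nat) (x y : R) : 0 < d -> x ^ 2 <= y ^ 2 ->
  potential d N x <= potential d N y.
Proof.
  intros Hd Hxy. induction N as [ | n IH]; [apply Rle_refl | ].
  apply Rplus_le_compat; [easy | ]. apply Rmult_le_compat_l; [lra | ].
  unfold heat_drop. apply Rplus_le_compat_l, Ropp_le_contravar, heat_kernel_antitone; [ | easy].
  now apply INR_S_mult_pos.
Qed.

Lemma potential_nonneg (d : R) (N : nat) (x : R) : 0 < d -> 0 <= potential d N x.
Proof.
  intros Hd. replace 0 with (potential d N 0).
  - apply potential_mono; [easy | nra].
  - induction N as [ | n IH]; [easy | ].
    simpl potential. rewrite IH. unfold heat_drop. ring.
Qed.

(** One heat step turns [heat_drop s] into itself plus [heat_kernel s r - heat_kernel (s + d) r];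
    over [s = d, ..., N * d] these corrections telescope. *)
Lemma line_conv_potential (d : R) (N : nat) (r : R) : 0 < d ->
  line_conv d (potential d N) r
    (potential d N r + d * heat_kernel d r - d * heat_kernel (INR (S N) * d) r).
Proof.
  intros Hd. induction N as [ | n IH].
  - simpl potential. simpl INR. rewrite Rmult_1_l.
    replace (0 + d * heat_kernel d r - d * heat_kernel d r) with (0 * 1 + 0 * 1) by ring.
    apply is_lim_ext with
      (fun L => RInt (fun y => heat_kernel d (r - y) * (0 * 1 + 0 * 1)) (- L) L).
    { intros L; apply RInt_ext; intros y _; simpl; ring. }
    apply (line_conv_lin d (fun _ => 1) (fun _ => 1)); try easy;
      try (intros; apply continuous_const); now apply line_conv_one.
  - pose proof (INR_S_mult_pos n d Hd) as Hn.
    set (s := INR (S n) * d) in *.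
    assert (Hs : INR (S (S n)) * d = s + d) by (rewrite (S_INR (S n)); unfold s; ring).
    rewrite Hs.
    assert (H1 := line_conv_lin d (fun _ => 1) (heat_kernel s) r 1 (heat_kernel (s + d) r)
      (d * heat_kernel s 0) (- d) Hd (fun y => continuous_const 1 y)
      (fun y => continuous_heat_kernel_id s y Hn) (line_conv_one d r Hd)
      (line_conv_heat_kernel s d r Hn Hd)).
    assert (C1 : forall y, continuous (fun y => d * heat_kernel s 0 * 1 + - d * heat_kernel s y) y).
    { intros y. apply (continuous_plus (fun _ => d * heat_kernel s 0 * 1)
        (fun y => - d * heat_kernel s y)); [apply continuous_const | ].
      apply (continuous_mult (fun _ => - d) (heat_kernel s)); [apply continuous_const | ].
      now apply continuous_heat_kernel_id. }
    assert (H2 := line_conv_lin d _ _ r _ _ 1 1 Hd (fun y => continuous_potential d n y Hd) C1 IH H1).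
    match type of H2 with line_conv _ _ _ ?v => replace
      (potential d (S n) r + d * heat_kernel d r - d * heat_kernel (s + d) r) with v end.
    2: { change (potential d (S n) r)
           with (potential d n r + d * (heat_kernel s 0 - heat_kernel s r)). ring. }
    apply is_lim_ext with (2 := H2).
    intros L; apply RInt_ext; intros y _.
    change (heat_kernel d (r - y) *
      (1 * potential d n y + 1 * (d * heat_kernel s 0 * 1 + - d * heat_kernel s y)) =
      heat_kernel d (r - y) * (potential d n y + d * (heat_kernel s 0 - heat_kernel s y))).
    ring.
Qed.

(** * Riemann-sum estimates for the potential *)

Lemma gauss_int_le (z : R) : gauss_int z <= sqrt (2 * PI) / 2.
Proof.
  rewrite <- sqrt_half_PI.
  destruct (Rle_dec (gauss_int z) 0) as [H | H].
  - pose proof (sqrt_pos (PI / 2)); lra.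
  - rewrite <- (sqrt_pow2 (gauss_int z)) by lra. apply sqrt_le_1_alt.
    pose proof (gauss_int_sqr z). pose proof (gauss_aux_bounds z). lra.
Qed.

Lemma gauss_le_1 (z : R) : gauss z <= 1.
Proof.
  unfold gauss. rewrite <- exp_0. apply exp_le_compat. pose proof (pow2_ge_0 z). lra.
Qed.

Lemma gauss_int_le_id (z : R) : 0 <= z -> gauss_int z <= z.
Proof.
  intros Hz. replace z with (RInt (fun _ => 1) 0 z) at 2
    by (rewrite RInt_const; unfold scal; simpl; unfold mult; simpl; ring).
  apply RInt_le; [easy | apply ex_RInt_gauss | apply ex_RInt_const | ].
  intros; apply gauss_le_1.
Qed.

(* An antiderivative in [s] of [heat_drop s x], tending to [0] as [s -> 0] and to [x] as
   [s -> oo]. *)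
Definition drop_int (x s : R) : R :=
  2 / sqrt (2 * PI) * (sqrt s * (1 - gauss (x / sqrt s)))
  + x * (1 - 2 / sqrt (2 * PI) * gauss_int (x / sqrt s)).

(** The terms containing the derivative [dz] of [x / sqrt s] cancel, because [gauss] has derivative
    [- z * gauss z]. Only the derivative of the factor [sqrt s] survives. *)
Lemma is_derive_drop_int (x s : R) : 0 < s -> is_derive (drop_int x) s (heat_drop s x).
Proof.
  intros Hs. pose proof (sqrt_lt_R0 s Hs) as Hq. pose proof sqrt_2PI_pos as Hc.
  set (dz := - x / (2 * (sqrt s * sqrt s) * sqrt s)).
  assert (Hz : is_derive (fun s => x / sqrt s) s dz).
  { unfold dz. auto_derive; [split; [easy | split; [lra | easy]] | ].
    field. lra. }
  assert (Hg : is_derive (fun s => gauss (x / sqrt s)) s (dz * (- (x / sqrt s) * gauss (x / sqrt s)))).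
  { apply (is_derive_comp gauss (fun s => x / sqrt s)); [ | easy].
    unfold gauss. auto_derive; [easy | ].
    change (- (x / sqrt s * (x / sqrt s * 1)) * / 2) with (- (x / sqrt s) ^ 2 / 2). field; lra. }
  assert (HI : is_derive (fun s => gauss_int (x / sqrt s)) s (dz * gauss (x / sqrt s))).
  { apply (is_derive_comp gauss_int (fun s => x / sqrt s)); [ | easy]. apply is_derive_gauss_int. }
  assert (Hr : is_derive sqrt s (/ (2 * sqrt s))).
  { auto_derive; [easy | field; lra]. }
  unfold drop_int. evar_last.
  - apply (is_derive_plus
      (fun s => 2 / sqrt (2 * PI) * (sqrt s * (1 - gauss (x / sqrt s))))
      (fun s => x * (1 - 2 / sqrt (2 * PI) * gauss_int (x / sqrt s)))).
    + apply (is_derive_scal (fun s => sqrt s * (1 - gauss (x / sqrt s)))).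
      apply (is_derive_mult sqrt (fun s => 1 - gauss (x / sqrt s))); [apply Hr | | apply Rmult_comm].
      apply (is_derive_minus (fun _ => 1) (fun s => gauss (x / sqrt s))); [ | apply Hg].
      apply is_derive_const.
    + apply (is_derive_scal (fun s => 1 - 2 / sqrt (2 * PI) * gauss_int (x / sqrt s))).
      apply (is_derive_minus (fun _ => 1) (fun s => 2 / sqrt (2 * PI) * gauss_int (x / sqrt s))).
      * apply is_derive_const.
      * apply (is_derive_scal (fun s => gauss_int (x / sqrt s))), HI.
  - unfold heat_drop. rewrite !heat_kernel_gauss by easy.
    replace (gauss (0 / sqrt s)) with 1.
    2: { unfold gauss. replace (- (0 / sqrt s) ^ 2 / 2) with 0 by (field; lra).
         now rewrite exp_0. }
    unfold minus, plus, opp, mult, zero, dz; simpl.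
    assert (Hss : s = sqrt s * sqrt s) by (rewrite sqrt_sqrt; lra).
    set (q := sqrt s) in *. set (e := gauss (x / q)). clearbody q e. clear Hz Hg HI Hr. subst s.
    field. lra.
Qed.

(** Both factors of [(1 - gauss (x / sqrt s)) * / (sqrt (2 * PI) * sqrt s)] are nonnegative and
    decrease in [s]. *)
Lemma heat_drop_antitone (s s' x : R) : 0 < s <= s' -> heat_drop s' x <= heat_drop s x.
Proof.
  intros [Hs Hss]. unfold heat_drop. rewrite !heat_kernel_gauss by lra.
  pose proof sqrt_2PI_pos as Hc. pose proof (sqrt_lt_R0 s Hs) as Hq.
  pose proof (sqrt_le_1_alt _ _ Hss) as Hqq.
  assert (H0 : forall q, 0 < q -> gauss (0 / q) = 1).
  { intros q H. unfold gauss. replace (- (0 / q) ^ 2 / 2) with 0 by (field; lra). apply exp_0. }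
  rewrite !H0 by lra.
  assert (Hg : gauss (x / sqrt s) <= gauss (x / sqrt s')).
  { unfold gauss. apply exp_le_compat. unfold Rdiv. rewrite !Rpow_mult_distr.
    assert (/ sqrt s' <= / sqrt s) by (apply Rinv_le_contravar; lra).
    assert (0 < / sqrt s') by (apply Rinv_0_lt_compat; lra).
    assert ((/ sqrt s') ^ 2 <= (/ sqrt s) ^ 2) by nra.
    pose proof (pow2_ge_0 x). nra. }
  pose proof (gauss_le_1 (x / sqrt s')).
  replace (1 / (sqrt (2 * PI) * sqrt s') - gauss (x / sqrt s') / (sqrt (2 * PI) * sqrt s'))
    with ((1 - gauss (x / sqrt s')) * / (sqrt (2 * PI) * sqrt s')) by (field; lra).
  replace (1 / (sqrt (2 * PI) * sqrt s) - gauss (x / sqrt s) / (sqrt (2 * PI) * sqrt s))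
    with ((1 - gauss (x / sqrt s)) * / (sqrt (2 * PI) * sqrt s)) by (field; lra).
  apply Rmult_le_compat; [lra | left; apply Rinv_0_lt_compat; nra | lra | ].
  apply Rinv_le_contravar; nra.
Qed.

Lemma drop_int_increment (x s d : R) : 0 < s -> 0 < d ->
  d * heat_drop (s + d) x <= drop_int x (s + d) - drop_int x s <= d * heat_drop s x.
Proof.
  intros Hs Hd.
  destruct (MVT_gen (drop_int x) s (s + d) (fun u => heat_drop u x)) as [c [Hc He]].
  - rewrite Rmin_left, Rmax_right by lra. intros u Hu. apply is_derive_drop_int; lra.
  - rewrite Rmin_left, Rmax_right by lra. intros u Hu.
    eapply continuity_pt_filterlim, continuous_of_derive, is_derive_drop_int; lra.
  - rewrite Rmin_left, Rmax_right in Hc by lra. rewrite He.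
    assert (heat_drop (s + d) x <= heat_drop c x) by (apply heat_drop_antitone; lra).
    assert (heat_drop c x <= heat_drop s x) by (apply heat_drop_antitone; lra).
    nra.
Qed.

(** The [n]-th term, taken at the left endpoint, dominates the integral over
    [[n * d, (n + 1) * d]]. *)
Lemma potential_ge_drop_int (d : R) (N : nat) (x : R) : 0 < d ->
  drop_int x (INR (S N) * d) - drop_int x d <= potential d N x.
Proof.
  intros Hd. induction N as [ | n IH].
  - simpl INR; simpl potential. rewrite Rmult_1_l. lra.
  - destruct (drop_int_increment x _ d (INR_S_mult_pos n d Hd) Hd) as [_ H].
    change (potential d (S n) x) with (potential d n x + d * heat_drop (INR (S n) * d) x).
    replace (INR (S (S n)) * d) with (INR (S n) * d + d) by (rewrite (S_INR (S n)); ring).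
    lra.
Qed.

(** Here the terms sit at right endpoints. The first is kept apart, since the increment bound
    requires a positive left endpoint and the interval [[0, d]] has none. *)
Lemma potential_le_drop_int (d : R) (N : nat) (x : R) : 0 < d ->
  potential d (S N) x <= d * heat_drop d x + drop_int x (INR (S N) * d) - drop_int x d.
Proof.
  intros Hd. induction N as [ | n IH].
  - simpl potential. rewrite Rmult_1_l. simpl INR. rewrite Rmult_1_l. lra.
  - destruct (drop_int_increment x _ d (INR_S_mult_pos n d Hd) Hd) as [H _].
    change (potential d (S (S n)) x)
      with (potential d (S n) x + d * heat_drop (INR (S (S n)) * d) x).
    replace (INR (S (S n)) * d) with (INR (S n) * d + d) by (rewrite (S_INR (S n)); ring).
    lra.
Qed.

Lemma two_div_sqrt_2PI : 0 < 2 / sqrt (2 * PI) <= 1.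
Proof.
  pose proof sqrt_2PI_ge_2. split; [apply Rdiv_lt_0_compat; lra | ].
  apply Rmult_le_reg_r with (sqrt (2 * PI)); [lra | ].
  unfold Rdiv. rewrite Rmult_assoc, Rinv_l; lra.
Qed.

Lemma two_div_sqrt_2PI_gauss_int_le (z : R) : 2 / sqrt (2 * PI) * gauss_int z <= 1.
Proof.
  pose proof sqrt_2PI_pos. destruct two_div_sqrt_2PI as [H0 _]. pose proof (gauss_int_le z).
  replace 1 with (2 / sqrt (2 * PI) * (sqrt (2 * PI) / 2)) by (field; lra).
  apply Rmult_le_compat_l; lra.
Qed.

Lemma drop_int_nonneg (x s : R) : 0 <= x -> 0 < s -> 0 <= drop_int x s.
Proof.
  intros Hx Hs. unfold drop_int.
  destruct two_div_sqrt_2PI as [H0 _]. pose proof (gauss_le_1 (x / sqrt s)).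
  pose proof (two_div_sqrt_2PI_gauss_int_le (x / sqrt s)). pose proof (sqrt_lt_R0 s Hs).
  apply Rplus_le_le_0_compat; repeat apply Rmult_le_pos; lra.
Qed.

Lemma drop_int_le (x s : R) : 0 <= x -> 0 < s -> drop_int x s <= x + x ^ 2 / sqrt s.
Proof.
  intros Hx Hs. unfold drop_int. pose proof (sqrt_lt_R0 s Hs) as Hq.
  destruct two_div_sqrt_2PI as [H0 H1].
  assert (Hz : 0 <= x / sqrt s) by (apply Rdiv_le_0_compat; lra).
  pose proof (gauss_int_nonneg _ Hz) as HI.
  assert (Hg : 1 - gauss (x / sqrt s) <= (x / sqrt s) ^ 2).
  { unfold gauss. pose proof (exp_ineq1_le (- (x / sqrt s) ^ 2 / 2)).
    pose proof (pow2_ge_0 (x / sqrt s)). lra. }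
  pose proof (gauss_le_1 (x / sqrt s)).
  assert (Hm : sqrt s * (1 - gauss (x / sqrt s)) <= x ^ 2 / sqrt s).
  { replace (x ^ 2 / sqrt s) with (sqrt s * (x / sqrt s) ^ 2) by (field; lra).
    apply Rmult_le_compat_l; lra. }
  assert (0 <= sqrt s * (1 - gauss (x / sqrt s))) by (apply Rmult_le_pos; lra).
  assert (0 <= 2 / sqrt (2 * PI) * gauss_int (x / sqrt s)) by (apply Rmult_le_pos; lra).
  nra.
Qed.

Lemma drop_int_ge (x s : R) : 0 <= x -> 0 < s -> x - x ^ 2 / sqrt s <= drop_int x s.
Proof.
  intros Hx Hs. unfold drop_int. pose proof (sqrt_lt_R0 s Hs) as Hq.
  destruct two_div_sqrt_2PI as [H0 H1].
  assert (Hz : 0 <= x / sqrt s) by (apply Rdiv_le_0_compat; lra).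
  pose proof (gauss_int_le_id _ Hz) as HI. pose proof (gauss_int_nonneg _ Hz).
  pose proof (gauss_le_1 (x / sqrt s)).
  assert (0 <= 2 / sqrt (2 * PI) * (sqrt s * (1 - gauss (x / sqrt s))))
    by (repeat apply Rmult_le_pos; lra).
  replace (x ^ 2 / sqrt s) with (x * (x / sqrt s)) by (field; lra).
  assert (2 / sqrt (2 * PI) * gauss_int (x / sqrt s) <= x / sqrt s) by nra.
  nra.
Qed.

(** The first summand is at most [sqrt d]; in the second, [gauss_int (x / sqrt d)] tends to half of
    [sqrt (2 * PI)]. The threshold depends on [x], which suffices because only two fixed points are
    used later. *)
Lemma drop_int_small (x eps : R) : 0 <= x -> 0 < eps ->
  exists d0, 0 < d0 /\ forall d, 0 < d < d0 -> drop_int x d <= eps.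
Proof.
  intros Hx He.
  destruct two_div_sqrt_2PI as [H0 H1]. pose proof sqrt_2PI_pos as Hc.
  assert (He' : 0 < eps / (2 * (x + 1))) by (apply Rdiv_lt_0_compat; lra).
  destruct (is_lim_gauss_int _ (locally_ball (sqrt (PI / 2)) (mkposreal _ He'))) as [Z HZ].
  set (m := Rmin (eps / 2) (x / (Rabs Z + 1))).
  assert (HZ1 : 0 < Rabs Z + 1) by (pose proof (Rabs_pos Z); lra).
  (* For [x > 0], [sqrt d < m] pushes [x / sqrt d] beyond Z. At [x = 0] the bound [m] would vanish,
     but then the second summand is zero. *)
  exists (if Rlt_dec 0 x then m ^ 2 else (eps / 2) ^ 2).
  assert (Hfirst : forall d, 0 < d -> sqrt d <= eps / 2 ->
    2 / sqrt (2 * PI) * (sqrt d * (1 - gauss (x / sqrt d))) <= eps / 2).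
  { intros d Hd Hsd. pose proof (sqrt_lt_R0 d Hd). pose proof (gauss_le_1 (x / sqrt d)).
    assert (0 < gauss (x / sqrt d)) by apply exp_pos.
    assert (0 <= sqrt d * (1 - gauss (x / sqrt d)) <= sqrt d) by nra. nra. }
  destruct (Rlt_dec 0 x) as [Hx0 | Hx0].
  - assert (Hm : 0 < m) by (apply Rmin_glb_lt; apply Rdiv_lt_0_compat; lra).
    split; [now apply pow_lt | ]. intros d [Hd Hdm].
    assert (Hsd : sqrt d < m).
    { rewrite <- (sqrt_pow2 m) by lra. apply sqrt_lt_1_alt; lra. }
    pose proof (Rmin_l (eps / 2) (x / (Rabs Z + 1))) as Hm1.
    pose proof (Rmin_r (eps / 2) (x / (Rabs Z + 1))) as Hm2. fold m in Hm1, Hm2.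
    pose proof (sqrt_lt_R0 d Hd) as Hq.
    specialize (Hfirst d Hd ltac:(lra)). unfold drop_int.
    assert (Hbig : Z < x / sqrt d).
    { apply Rmult_lt_reg_r with (sqrt d); [easy | ].
      unfold Rdiv. rewrite Rmult_assoc, Rinv_l, Rmult_1_r by lra.
      assert (Hs2 : sqrt d * (Rabs Z + 1) < x).
      { apply Rmult_lt_reg_r with (/ (Rabs Z + 1)); [now apply Rinv_0_lt_compat | ].
        rewrite Rmult_assoc, Rinv_r by lra. unfold Rdiv in Hm2. lra. }
      pose proof (Rle_abs Z). nra. }
    specialize (HZ _ Hbig).
    change (Rabs (gauss_int (x / sqrt d) - sqrt (PI / 2)) < eps / (2 * (x + 1))) in HZ.
    rewrite sqrt_half_PI in HZ. apply Rabs_def2 in HZ. destruct HZ as [_ HZ].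
    set (g := gauss_int (x / sqrt d)) in *.
    assert (Hone : 1 - 2 / sqrt (2 * PI) * g <= eps / (2 * (x + 1))).
    { replace 1 with (2 / sqrt (2 * PI) * (sqrt (2 * PI) / 2)) at 1 by (field; lra). nra. }
    assert (x * (1 - 2 / sqrt (2 * PI) * g) <= x * (eps / (2 * (x + 1))))
      by (apply Rmult_le_compat_l; lra).
    assert (x * (eps / (2 * (x + 1))) <= eps / 2).
    { replace (eps / 2) with ((x + 1) * (eps / (2 * (x + 1)))) by (field; lra). nra. }
    lra.
  - assert (x = 0) by lra.
    split; [apply pow_lt; lra | ]. intros d [Hd Hdm].
    assert (Hsd : sqrt d < eps / 2).
    { rewrite <- (sqrt_pow2 (eps / 2)) by lra. apply sqrt_lt_1_alt; lra. }
    specialize (Hfirst d Hd ltac:(lra)). unfold drop_int.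
    assert (x * (1 - 2 / sqrt (2 * PI) * gauss_int (x / sqrt d)) = 0) by (subst x; ring).
    lra.
Qed.

Lemma potential_le (d : R) (N : nat) (x : R) : 0 < d -> 0 <= x -> (0 < N)%nat ->
  potential d N x <= sqrt d + x + x ^ 2 / sqrt (INR N * d).
Proof.
  intros Hd Hx HN. destruct N as [ | n]; [lia | ].
  pose proof (potential_le_drop_int d n x Hd) as H1.
  pose proof (drop_int_le x _ Hx (INR_S_mult_pos n d Hd)) as H2.
  pose proof (drop_int_nonneg x d Hx Hd) as H3.
  assert (H4 : d * heat_drop d x <= sqrt d).
  { pose proof (sqrt_lt_R0 d Hd). unfold heat_drop.
    pose proof (heat_kernel_pos d x Hd). pose proof (heat_kernel_le_inv_sqrt d 0 Hd).
    apply Rle_trans with (d * / (2 * sqrt d)).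
    - apply Rmult_le_compat_l; lra.
    - rewrite <- (sqrt_sqrt d) at 1 by lra.
      replace (sqrt d * sqrt d * / (2 * sqrt d)) with (sqrt d / 2) by (field; lra). lra. }
  lra.
Qed.

Lemma potential_ge (d : R) (N : nat) (x : R) : 0 < d -> 0 <= x -> (0 < N)%nat ->
  x - x ^ 2 / sqrt (INR N * d) - drop_int x d <= potential d N x.
Proof.
  intros Hd Hx HN.
  pose proof (potential_ge_drop_int d N x Hd) as H1.
  pose proof (drop_int_ge x _ Hx (INR_S_mult_pos N d Hd)) as H2.
  assert (HNd : 0 < INR N * d) by (apply Rmult_lt_0_compat; [now apply lt_0_INR | easy]).
  assert (x ^ 2 / sqrt (INR (S N) * d) <= x ^ 2 / sqrt (INR N * d)).
  { apply Rmult_le_compat_l; [apply pow2_ge_0 | ].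
    apply Rinv_le_contravar; [now apply sqrt_lt_R0 | ].
    apply sqrt_le_1_alt. rewrite S_INR. nra. }
  lra.
Qed.

(** * The Neumann kernel and the killed operator *)

(* From [exp (- u) <= 27 / u ^ 3] at [u = (1 - Rc) ^ 2 / (2 * d)]: for [r] in [0,Rc] the [n]-th
   images of a point of [0,1] are at distance at least [n * (1 - Rc)] from [r]. *)
Definition image_const (Rc : R) : R := 216 / (1 - Rc) ^ 6.

Lemma image_const_pos (Rc : R) : Rc < 1 -> 0 < image_const Rc.
Proof. intros H. apply Rdiv_lt_0_compat; [lra | apply pow_lt; lra]. Qed.

(** The second clause forces [image_exp Rc d <= 1 / 2], so the distant images are dominated by a
    geometric series of ratio 1/2. *)
Definition small_time (Rc d : R) : Prop := 0 < d < 1 /\ image_const Rc * d <= 1 / 2.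

Definition image_exp (Rc d : R) : R := exp (- ((1 - Rc) ^ 2 / (2 * d))).

Lemma image_exp_le (Rc d : R) : Rc < 1 -> 0 < d ->
  image_exp Rc d <= image_const Rc * d ^ 3.
Proof.
  intros HR Hd. unfold image_exp, image_const.
  eapply Rle_trans; [apply exp_neg_le_cube, Rdiv_lt_0_compat; [apply pow_lt | ]; lra | ].
  right. field. lra.
Qed.

Lemma image_exp_le_half (Rc d : R) : Rc < 1 -> small_time Rc d -> image_exp Rc d <= 1 / 2.
Proof.
  intros HR [Hd Hs]. eapply Rle_trans; [apply image_exp_le; lra | ].
  pose proof (image_const_pos Rc HR). assert (d ^ 3 <= d) by nra. nra.
Qed.

Lemma exp_mult_INR (a : R) (n : nat) : exp (a * INR n) = exp a ^ n.
Proof.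
  induction n as [ | n IH]; [simpl; rewrite Rmult_0_r; apply exp_0 | ].
  rewrite S_INR, Rmult_plus_distr_l, exp_plus, IH, Rmult_1_r. simpl. ring.
Qed.

(** With [n = S k], the inequality [n ^ 2 >= n] bounds the exponential by [image_exp Rc d ^ n]: one
    factor supplies [d ^ 3], the other [k] the ratio 1/2. The normalisation costs at most [/ d]. *)
Lemma heat_kernel_image_le (Rc d x : R) (k : nat) : Rc < 1 -> small_time Rc d ->
  INR (S k) * (1 - Rc) <= Rabs x ->
  heat_kernel d x <= image_const Rc * d ^ 2 * (1 / 2) ^ k.
Proof.
  intros HR Hs Hx. pose proof (image_exp_le_half Rc d HR Hs) as Hq.
  destruct Hs as [Hd Hs].
  pose proof (image_exp_le Rc d HR ltac:(lra)) as Hq3.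
  assert (Hexp : exp (- x ^ 2 / (2 * d)) <= image_exp Rc d * (1 / 2) ^ k).
  { apply Rle_trans with (image_exp Rc d ^ (S k)).
    - unfold image_exp. rewrite <- exp_mult_INR. apply exp_le_compat.
      assert (Hn : 1 <= INR (S k)) by (rewrite S_INR; pose proof (pos_INR k); lra).
      assert (Hx2 : INR (S k) * (1 - Rc) ^ 2 <= x ^ 2).
      { rewrite <- (pow2_abs x).
        assert ((INR (S k) * (1 - Rc)) ^ 2 <= Rabs x ^ 2)
          by (apply pow_incr; split; [apply Rmult_le_pos; lra | easy]).
        pose proof (pow2_ge_0 (1 - Rc)). nra. }
      replace (- ((1 - Rc) ^ 2 / (2 * d)) * INR (S k)) with (- (INR (S k) * (1 - Rc) ^ 2) / (2 * d))
        by (field; lra).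
      apply Rmult_le_compat_r; [left; apply Rinv_0_lt_compat; lra | lra].
    - assert (0 < image_exp Rc d) by apply exp_pos. simpl.
      apply Rmult_le_compat_l; [lra | ]. apply pow_incr. lra. }
  assert (Hsq : d <= sqrt (2 * PI * d)).
  { rewrite <- (sqrt_pow2 d) at 1 by lra. apply sqrt_le_1_alt.
    pose proof PI2_3_2. nra. }
  assert (Hk : 0 < (1 / 2) ^ k) by (apply pow_lt; lra).
  unfold heat_kernel.
  apply Rle_trans with (image_const Rc * d ^ 3 * (1 / 2) ^ k * / d).
  - apply Rmult_le_compat.
    + left; apply exp_pos.
    + left; apply Rinv_0_lt_compat; lra.
    + eapply Rle_trans; [apply Hexp | ]. apply Rmult_le_compat_r; lra.
    + apply Rinv_le_contravar; lra.
  - right. field. lra.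
Qed.

Definition half_kernel (d r y : R) : R := heat_kernel d (r - y) + heat_kernel d (r + y).

Lemma half_kernel_pos (d r y : R) : 0 < d -> 0 < half_kernel d r y.
Proof.
  intros Hd. unfold half_kernel.
  pose proof (heat_kernel_pos d (r - y) Hd). pose proof (heat_kernel_pos d (r + y) Hd). lra.
Qed.

(** The tight case is the reflection of [y] across 1, at distance [2 - r - y >= 1 - Rc]: near
    [r = 1] this image would not be negligible. *)
Lemma neum_term_S_bounds (Rc d r y : R) (k : nat) : Rc < 1 -> small_time Rc d ->
  Rabs r <= Rc -> Rabs y <= 1 ->
  0 <= neum_term d r y (S k) <= 4 * image_const Rc * d ^ 2 * (1 / 2) ^ k.
Proof.
  intros HR Hs Hr Hy. pose proof Hs as [[Hd _] _].
  cbv beta delta [neum_term] iota.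
  assert (Hn : 1 <= INR (S k)) by (rewrite S_INR; pose proof (pos_INR k); lra).
  assert (Hk : forall x, INR (S k) * (1 - Rc) <= Rabs x ->
    0 <= heat_kernel d x <= image_const Rc * d ^ 2 * (1 / 2) ^ k).
  { intros x Hx. split; [left; now apply heat_kernel_pos | now apply heat_kernel_image_le]. }
  apply Rabs_le_between in Hr. apply Rabs_le_between in Hy.
  destruct (Hk (r - y - 2 * INR (S k))).
  { rewrite Rabs_left1 by lra. nra. }
  destruct (Hk (r - y + 2 * INR (S k))).
  { rewrite Rabs_right by lra. nra. }
  destruct (Hk (r + y - 2 * INR (S k))).
  { rewrite Rabs_left1 by lra. nra. }
  destruct (Hk (r + y + 2 * INR (S k))).
  { rewrite Rabs_right by lra. nra. }
  lra.
Qed.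

Lemma ex_series_half_pow (c : R) : ex_series (fun k => c * (1 / 2) ^ k).
Proof.
  apply (ex_series_scal_l (K := R_AbsRing) (V := R_NormedModule) c (fun k => (1 / 2) ^ k)).
  apply ex_series_geom. rewrite Rabs_right; lra.
Qed.

Lemma G_neum_bounds (Rc d r y : R) : Rc < 1 -> small_time Rc d ->
  Rabs r <= Rc -> Rabs y <= 1 ->
  half_kernel d r y <= G_neum d r y <= half_kernel d r y + 8 * image_const Rc * d ^ 2.
Proof.
  intros HR Hs Hr Hy. unfold G_neum.
  set (c := 4 * image_const Rc * d ^ 2).
  assert (Hb : forall k, 0 <= neum_term d r y (S k) <= c * (1 / 2) ^ k)
    by (intros k; now apply neum_term_S_bounds).
  assert (Hex : ex_series (fun k => neum_term d r y (S k))).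
  { apply (ex_series_le (K := R_AbsRing) (V := R_CompleteNormedModule)) with (fun k => c * (1 / 2) ^ k).
    - intros k. change (Rabs (neum_term d r y (S k)) <= c * (1 / 2) ^ k).
      rewrite Rabs_right; [apply Hb | apply Rle_ge, Hb].
    - apply ex_series_half_pow. }
  rewrite Series_incr_1 by (now apply ex_series_incr_1).
  change (neum_term d r y 0) with (half_kernel d r y).
  assert (H0 : 0 <= Series (fun k => neum_term d r y (S k))).
  { replace 0 with (Series (fun k => 0 * (1 / 2) ^ k)).
    - apply Series_le; [ | easy]. intros k; rewrite Rmult_0_l; split; [lra | apply Hb].
    - rewrite (Series_scal_l 0). ring. }
  assert (H1 : Series (fun k => neum_term d r y (S k)) <= 2 * c).
  { replace (2 * c) with (Series (fun k => c * (1 / 2) ^ k)).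
    - apply Series_le; [apply Hb | apply ex_series_half_pow].
    - rewrite (Series_scal_l c), Series_geom by (rewrite Rabs_right; lra). field. }
  unfold c in H1. lra.
Qed.

Lemma continuous_neum_term (d r y : R) (n : nat) : 0 < d -> continuous (fun y => neum_term d r y n) y.
Proof.
  intros Hd.
  assert (Hm : forall a, continuous (fun y => heat_kernel d (r - y + a)) y).
  { intros a. apply continuous_ext with (fun y => heat_kernel d ((r + a) - y)).
    - intros x; f_equal; ring.
    - now apply continuous_heat_kernel. }
  assert (Hp : forall a, continuous (fun y => heat_kernel d (r + y + a)) y).
  { intros a. apply continuous_ext with (fun y => heat_kernel d ((- r - a) - y)).
    - intros x. rewrite <- heat_kernel_opp. f_equal; ring.
    - now apply continuous_heat_kernel. }
  destruct n as [ | k].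
  - apply (continuous_plus (fun y => heat_kernel d (r - y)) (fun y => heat_kernel d (r + y))).
    + now apply continuous_heat_kernel.
    + apply continuous_ext with (2 := Hp 0). intros; f_equal; ring.
  - apply (continuous_plus (fun y => heat_kernel d (r - y - 2 * INR (S k))
      + heat_kernel d (r - y + 2 * INR (S k)) + heat_kernel d (r + y - 2 * INR (S k)))
      (fun y => heat_kernel d (r + y + 2 * INR (S k)))); [ | apply Hp].
    apply (continuous_plus (fun y => heat_kernel d (r - y - 2 * INR (S k))
      + heat_kernel d (r - y + 2 * INR (S k))) (fun y => heat_kernel d (r + y - 2 * INR (S k))));
      [ | apply Hp].
    apply (continuous_plus (fun y => heat_kernel d (r - y - 2 * INR (S k)))
      (fun y => heat_kernel d (r - y + 2 * INR (S k)))); apply Hm.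
Qed.

(** The Weierstrass M-test on the ball of radius 1 about 0, whence the strict bound on [y];
    integrals over [[0, Rc]] stay inside it. *)
Lemma continuous_G_neum (Rc d r y : R) : Rc < 1 -> small_time Rc d ->
  Rabs r <= Rc -> Rabs y < 1 -> continuous (G_neum d r) y.
Proof.
  intros HR Hs Hr Hy. pose proof Hs as [[Hd _] _].
  set (c := 4 * image_const Rc * d ^ 2).
  assert (Hc : 0 <= c).
  { pose proof (image_const_pos Rc HR). unfold c. pose proof (pow2_ge_0 d). apply Rmult_le_pos; lra. }
  set (An := fun n => match n with O => / sqrt d | S k => c * (1 / 2) ^ k end).
  assert (HAn : forall n, 0 <= An n).
  { intros [ | k]; simpl.
    - left; apply Rinv_0_lt_compat, sqrt_lt_R0, Hd.
    - apply Rmult_le_pos; [easy | apply pow_le; lra]. }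
  assert (HCVN : CVN_r (fun n y => neum_term d r y n) (mkposreal 1 Rlt_0_1)).
  { exists An, (Series An). split.
    - apply is_lim_seq_Reals.
      apply is_lim_seq_ext with (sum_n An).
      { intros n. rewrite sum_n_Reals. apply sum_eq. intros i _.
        symmetry. apply Rabs_right, Rle_ge, HAn. }
      apply (Series_correct An). apply ex_series_incr_1. apply ex_series_half_pow.
    - intros n x Hx. unfold Boule in Hx. simpl in Hx. rewrite Rminus_0_r in Hx.
      destruct n as [ | k].
      + change (Rabs (half_kernel d r x) <= / sqrt d).
        rewrite Rabs_right by (left; now apply half_kernel_pos).
        unfold half_kernel.
        pose proof (heat_kernel_le_inv_sqrt d (r - x) Hd).
        pose proof (heat_kernel_le_inv_sqrt d (r + x) Hd).
        pose proof (sqrt_lt_R0 d Hd).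
        replace (/ sqrt d) with (/ (2 * sqrt d) + / (2 * sqrt d)) by (field; lra). lra.
      + destruct (neum_term_S_bounds Rc d r x k HR Hs Hr) as [H0 H1]; [lra | ].
        rewrite Rabs_right by lra. apply H1. }
  destruct (CVN_CVU_r _ _ HCVN y Hy) as [e He].
  apply continuity_pt_filterlim.
  apply (CVU_continuity _ _ y e He).
  - intros n x _. unfold SP.
    induction n as [ | n IH]; simpl.
    + apply continuity_pt_filterlim, (continuous_neum_term d r x 0 Hd).
    + apply (continuity_pt_plus (fun x => sum_f_R0 (fun k => neum_term d r x k) n)
        (fun x => neum_term d r x (S n))); [apply IH | ].
      apply continuity_pt_filterlim, (continuous_neum_term d r x (S n) Hd).
  - unfold Boule. rewrite Rminus_diag, Rabs_R0. apply cond_pos.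
Qed.

Definition killed_op (d Rc : R) (w : R -> R) (r : R) : R :=
  RInt (fun y => G_neum d r y * w y) 0 Rc.

Lemma ex_RInt_killed_op (d Rc : R) (w : R -> R) (r : R) :
  0 < Rc < 1 -> small_time Rc d -> (forall y, continuous w y) -> 0 <= r <= Rc ->
  ex_RInt (fun y => G_neum d r y * w y) 0 Rc.
Proof.
  intros HR Hs Hw Hr. apply (ex_RInt_continuous (V := R_CompleteNormedModule)).
  rewrite Rmin_left, Rmax_right by lra. intros y Hy.
  apply (continuous_mult (G_neum d r) w); [ | easy].
  apply continuous_G_neum with Rc; try easy; try lra; rewrite Rabs_right; lra.
Qed.

Lemma killed_op_le (d Rc : R) (w1 w2 : R -> R) (r : R) :
  0 < Rc < 1 -> small_time Rc d -> (forall y, continuous w1 y) -> (forall y, continuous w2 y) ->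
  0 <= r <= Rc -> (forall y, 0 <= y <= Rc -> w1 y <= w2 y) ->
  killed_op d Rc w1 r <= killed_op d Rc w2 r.
Proof.
  intros HR Hs H1 H2 Hr Hle. apply RInt_le; try lra; try now apply ex_RInt_killed_op.
  intros y Hy. apply Rmult_le_compat_l; [ | apply Hle; lra].
  destruct (G_neum_bounds Rc d r y) as [HG _]; try easy; try lra; try (rewrite Rabs_right; lra).
  pose proof (half_kernel_pos d r y ltac:(apply Hs)). lra.
Qed.

Lemma killed_op_lin (d Rc : R) (w1 w2 : R -> R) (r a b : R) :
  0 < Rc < 1 -> small_time Rc d -> (forall y, continuous w1 y) -> (forall y, continuous w2 y) ->
  0 <= r <= Rc ->
  killed_op d Rc (fun y => a * w1 y + b * w2 y) r
  = a * killed_op d Rc w1 r + b * killed_op d Rc w2 r.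
Proof.
  intros HR Hs H1 H2 Hr. apply is_RInt_unique.
  apply is_RInt_ext with (fun y =>
    plus (scal a (G_neum d r y * w1 y)) (scal b (G_neum d r y * w2 y))).
  { intros y _; unfold plus, scal; simpl; unfold mult; simpl; ring. }
  apply (is_RInt_plus (V := R_NormedModule)); apply (is_RInt_scal (V := R_NormedModule)).
  - apply (RInt_correct (fun y => G_neum d r y * w1 y)). now apply ex_RInt_killed_op.
  - apply (RInt_correct (fun y => G_neum d r y * w2 y)). now apply ex_RInt_killed_op.
Qed.

Lemma continuous_lin (w1 w2 : R -> R) (a b y : R) : continuous w1 y -> continuous w2 y ->
  continuous (fun y => a * w1 y + b * w2 y) y.
Proof.
  intros H1 H2. apply (continuous_plus (fun y => a * w1 y) (fun y => b * w2 y)).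
  - apply (continuous_mult (fun _ => a) w1); [apply continuous_const | easy].
  - apply (continuous_mult (fun _ => b) w2); [apply continuous_const | easy].
Qed.

(* Compare [w] with its best multiple of the strict supersolution [b]: at the point where
   [w / b] is maximal, a positive maximum would contradict [killed_op b < b]. *)
Lemma killed_op_max_principle (d Rc : R) (b w : R -> R) :
  0 < Rc < 1 -> small_time Rc d -> (forall y, continuous b y) -> (forall y, continuous w y) ->
  (forall y, 0 <= y <= Rc -> 0 < b y) ->
  (forall r, 0 <= r <= Rc -> killed_op d Rc b r < b r) ->
  (forall r, 0 <= r <= Rc -> w r <= killed_op d Rc w r) ->
  forall r, 0 <= r <= Rc -> w r <= 0.
Proof.
  intros HR Hs Cb Cw Hb HTb HTw.
  destruct (continuity_ab_maj (fun y => w y / b y) 0 Rc) as [x0 [Hmax Hx0]]; [lra | | ].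
  { intros y Hy. apply continuity_pt_div.
    - apply continuity_pt_filterlim, Cw.
    - apply continuity_pt_filterlim, Cb.
    - pose proof (Hb y Hy); lra. }
  set (m := w x0 / b x0) in *.
  assert (Hwm : forall y, 0 <= y <= Rc -> w y <= m * b y).
  { intros y Hy. pose proof (Hb y Hy). pose proof (Hmax y Hy).
    replace (w y) with (w y / b y * b y) by (field; lra). apply Rmult_le_compat_r; lra. }
  assert (Hm : m <= 0).
  { destruct (Rle_dec m 0) as [ | Hm]; [easy | exfalso].
    assert (Hle : killed_op d Rc w x0 <= killed_op d Rc (fun y => m * b y + 0 * b y) x0).
    { apply killed_op_le; try easy.
      - intros y; now apply continuous_lin.
      - intros y Hy. pose proof (Hwm y Hy). lra. }
    rewrite killed_op_lin in Hle by easy.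
    pose proof (HTb x0 Hx0). pose proof (HTw x0 Hx0). pose proof (Hb x0 Hx0).
    assert (w x0 = m * b x0) by (unfold m; field; lra). nra. }
  intros r Hr. pose proof (Hwm r Hr). pose proof (Hb r Hr). nra.
Qed.

(** * Comparison of the killed operator with the heat kernel on the line *)

Lemma killed_half_op_fold (d Rc : R) (w : R -> R) (r : R) : 0 < d ->
  (forall y, continuous w y) -> (forall y, w (- y) = w y) ->
  is_RInt (fun y => half_kernel d r y * w y) 0 Rc
    (RInt (fun y => heat_kernel d (r - y) * w y) (- Rc) Rc).
Proof.
  intros Hd Cw Ew. set (f := fun y => heat_kernel d (r - y) * w y).
  assert (Hex : forall a b, ex_RInt f a b) by (intros; now apply ex_RInt_heat_kernel_mult).
  assert (H1 : is_RInt f 0 Rc (RInt f 0 Rc)) by apply (RInt_correct f), Hex.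
  assert (H2 : is_RInt f (- 0) (- Rc) (RInt f (- 0) (- Rc))) by apply (RInt_correct f), Hex.
  (* The substitution carries its sign and yields the integrand [- f (- y)], hence a difference of
     integrals where the folding is a sum. *)
  apply (is_RInt_comp_opp f 0 Rc) in H2.
  assert (H3 := is_RInt_minus _ _ _ _ _ _ H1 H2).
  replace (RInt f (- Rc) Rc) with (minus (RInt f 0 Rc) (RInt f (- 0) (- Rc))).
  - eapply is_RInt_ext; [ | apply H3]. intros y _.
    unfold f, half_kernel, minus, plus, opp; simpl. rewrite Ew.
    replace (r - - y) with (r + y) by ring. ring.
  - rewrite Ropp_0. rewrite <- (RInt_Chasles f (- Rc) 0 Rc) by apply Hex.
    rewrite <- (opp_RInt_swap f (- Rc) 0) by apply Hex.
    unfold minus, plus, opp; simpl. ring.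
Qed.

Lemma RInt_le_wider (h : R -> R) (a L : R) : (forall y, continuous h y) -> 0 <= a <= L ->
  (forall y, a <= Rabs y -> 0 <= h y) -> RInt h (- a) a <= RInt h (- L) L.
Proof.
  intros Ch HaL Hh.
  assert (Hex : forall a b, ex_RInt h a b)
    by (intros; apply (ex_RInt_continuous (V := R_CompleteNormedModule)); intros; apply Ch).
  rewrite <- (RInt_Chasles h (- L) (- a) L) by apply Hex.
  rewrite <- (RInt_Chasles h (- a) a L) by apply Hex.
  assert (0 <= RInt h (- L) (- a)).
  { apply RInt_ge_0; [lra | apply Hex | ]. intros y Hy. apply Hh. rewrite Rabs_left1; lra. }
  assert (0 <= RInt h a L).
  { apply RInt_ge_0; [lra | apply Hex | ]. intros y Hy. apply Hh. rewrite Rabs_right; lra. }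
  unfold plus; simpl. lra.
Qed.

(** No error term appears: restricting to [[-Rc, Rc]] discards only nonpositive values of [w], and
    the distant images act where [w] is nonnegative. *)
Lemma killed_op_ge_line_conv (d Rc : R) (w : R -> R) (r v : R) :
  0 < Rc < 1 -> small_time Rc d -> (forall y, continuous w y) -> (forall y, w (- y) = w y) ->
  (forall y, 0 <= y <= Rc -> 0 <= w y) -> (forall y, Rc <= Rabs y -> w y <= 0) ->
  0 <= r <= Rc -> line_conv d w r v -> v <= killed_op d Rc w r.
Proof.
  intros HR Hs Cw Ew Hin Hout Hr Hv. pose proof Hs as [[Hd _] _].
  apply Rle_trans with (RInt (fun y => heat_kernel d (r - y) * w y) (- Rc) Rc).
  - change (Rbar_le v (RInt (fun y => heat_kernel d (r - y) * w y) (- Rc) Rc)).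
    eapply is_lim_le_loc; [ | apply Hv | apply is_lim_const].
    exists Rc. intros L HL.
    assert (Hwide : RInt (fun y => - (heat_kernel d (r - y) * w y)) (- Rc) Rc
                    <= RInt (fun y => - (heat_kernel d (r - y) * w y)) (- L) L).
    { apply RInt_le_wider; [ | lra | ].
      - intros y. apply (continuous_opp (fun y => heat_kernel d (r - y) * w y)).
        now apply continuous_heat_kernel_mult.
      - intros y Hy. pose proof (Hout y Hy). pose proof (heat_kernel_pos d (r - y) Hd). nra. }
    assert (Hopp : forall a, RInt (fun y => - (heat_kernel d (r - y) * w y)) (- a) a
      = - RInt (fun y => heat_kernel d (r - y) * w y) (- a) a).
    { intros a. apply (RInt_opp (fun y => heat_kernel d (r - y) * w y)).
      now apply ex_RInt_heat_kernel_mult. }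
    rewrite !Hopp in Hwide. lra.
  - pose proof (killed_half_op_fold d Rc w r Hd Cw Ew) as Hf.
    rewrite <- (is_RInt_unique _ _ _ _ Hf).
    apply RInt_le; [lra | eexists; apply Hf | now apply ex_RInt_killed_op | ].
    intros y Hy. apply Rmult_le_compat_r; [apply Hin; lra | ].
    apply (G_neum_bounds Rc); try easy; try lra; rewrite Rabs_right; lra.
Qed.

(** Half of the exponent pays for the small factor; the other half remains as a kernel of time
    [2 * d], which can still be integrated against a quadratic. The ratio [sqrt 2] of the
    normalisations is rounded up to 2. *)
Lemma heat_kernel_tail_le (d e x : R) : 0 < d -> 0 <= e <= Rabs x ->
  heat_kernel d x <= 2 * exp (- (e ^ 2 / (4 * d))) * heat_kernel (2 * d) x.
Proof.
  intros Hd Hx. pose proof PI_RGT_0. unfold heat_kernel.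
  assert (Hq : 0 < sqrt (2 * PI * d)) by (apply sqrt_lt_R0; nra).
  assert (Hq2 : 0 < sqrt (2 * PI * (2 * d)) <= 2 * sqrt (2 * PI * d)).
  { split; [apply sqrt_lt_R0; nra | ].
    replace (2 * sqrt (2 * PI * d)) with (sqrt (2 ^ 2 * (2 * PI * d)))
      by (rewrite sqrt_mult, sqrt_pow2 by nra; easy).
    apply sqrt_le_1_alt. nra. }
  assert (He : exp (- x ^ 2 / (2 * d)) <= exp (- (e ^ 2 / (4 * d))) * exp (- x ^ 2 / (2 * (2 * d)))).
  { rewrite <- exp_plus. apply exp_le_compat.
    assert (e ^ 2 <= x ^ 2) by (rewrite <- (pow2_abs x); apply pow_incr; lra).
    replace (- x ^ 2 / (2 * d)) with (- x ^ 2 / (4 * d) + - x ^ 2 / (2 * (2 * d))) by (field; lra).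
    apply Rplus_le_compat_r.
    replace (- (e ^ 2 / (4 * d))) with (- e ^ 2 / (4 * d)) by (field; lra).
    apply Rmult_le_compat_r; [left; apply Rinv_0_lt_compat; lra | lra]. }
  apply Rle_trans with
    (exp (- (e ^ 2 / (4 * d))) * exp (- x ^ 2 / (2 * (2 * d))) * / sqrt (2 * PI * d)).
  - apply Rmult_le_compat_r; [left; now apply Rinv_0_lt_compat | easy].
  - replace (2 * exp (- (e ^ 2 / (4 * d))) * (exp (- x ^ 2 / (2 * (2 * d))) / sqrt (2 * PI * (2 * d))))
      with (exp (- (e ^ 2 / (4 * d))) * exp (- x ^ 2 / (2 * (2 * d))) * (2 / sqrt (2 * PI * (2 * d))))
      by (field; lra).
    apply Rmult_le_compat_l; [apply Rlt_le, Rmult_lt_0_compat; apply exp_pos | ].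
    replace (2 / sqrt (2 * PI * (2 * d))) with (/ (sqrt (2 * PI * (2 * d)) / 2)) by (field; lra).
    apply Rinv_le_contravar; lra.
Qed.

(** Discarding the zone between Rc and [Rc + e] loses only nonnegative values. Beyond it [w] may be
    as negative as the quadratic allows, but at distance at least [e] from [r]: this is the second
    term. The third bounds the distant images by means of [w <= W]. *)
Lemma killed_op_le_line_conv (d Rc e A B W : R) (w : R -> R) (r v : R) :
  0 < Rc < 1 -> small_time Rc d -> 0 < e -> (forall y, continuous w y) ->
  (forall y, w (- y) = w y) ->
  (forall y, Rabs y <= Rc + e -> 0 <= w y) -> (forall y, 0 <= y <= Rc -> w y <= W) ->
  0 <= A -> 0 <= B -> (forall y, - (A + B * y ^ 2) <= w y) ->
  0 <= r <= Rc -> line_conv d w r v ->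
  killed_op d Rc w r <=
    v + 2 * exp (- (e ^ 2 / (4 * d))) * (A + B * (r ^ 2 + 2 * d)) + 8 * image_const Rc * d ^ 2 * W.
Proof.
  intros HR Hs He Cw Ew Hin HW HA HB HAB Hr Hv. pose proof Hs as [[Hd _] _].
  set (E := 2 * exp (- (e ^ 2 / (4 * d)))).
  assert (HE : 0 < E) by (unfold E; pose proof (exp_pos (- (e ^ 2 / (4 * d)))); lra).
  set (p := fun y => A * 1 + B * y ^ 2).
  assert (Cone : forall y : R, continuous (fun _ => 1) y) by (intros; apply continuous_const).
  assert (Cp : forall y, continuous p y).
  { intros y. apply (continuous_lin (fun _ => 1) (fun y => y ^ 2)); [easy | apply continuous_sqr]. }
  assert (Hp : line_conv (2 * d) p r (A * 1 + B * (r ^ 2 + 2 * d))).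
  { apply (line_conv_lin (2 * d) (fun _ => 1) (fun y => y ^ 2)); try easy; try lra.
    - apply continuous_sqr.
    - apply line_conv_one; lra.
    - apply line_conv_sqr; lra. }
  set (f := fun y => heat_kernel d (r - y) * w y).
  set (g := fun y => heat_kernel (2 * d) (r - y) * p y).
  assert (Hexf : forall a b, ex_RInt f a b) by (intros; now apply ex_RInt_heat_kernel_mult).
  assert (Hexg : forall a b, ex_RInt g a b)
    by (intros; apply ex_RInt_heat_kernel_mult; [lra | easy]).
  assert (Hgpos : forall y, 0 <= g y).
  { intros y. apply Rmult_le_pos; [left; apply heat_kernel_pos; lra | ].
    unfold p. pose proof (pow2_ge_0 y). nra. }
  (* Adding [E * g] compensates the negative tail of [f]: the sum is nonnegative off [[-Rc, Rc]], so
     its integral can only grow when the interval widens to the line. *)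
  assert (Hline : RInt f (- Rc) Rc <= v + E * (A * 1 + B * (r ^ 2 + 2 * d))).
  { assert (Hlin : forall a b, RInt (fun y => f y + E * g y) a b = RInt f a b + E * RInt g a b).
    { intros a b. apply is_RInt_unique.
      apply (is_RInt_plus f (fun y => E * g y)); [apply (RInt_correct f), Hexf | ].
      apply (is_RInt_scal g), (RInt_correct g), Hexg. }
    change (Rbar_le (RInt f (- Rc) Rc) (v + E * (A * 1 + B * (r ^ 2 + 2 * d)))).
    apply is_lim_le_loc with (fun _ => RInt f (- Rc) Rc)
      (fun L => RInt f (- L) L + E * RInt g (- L) L) p_infty.
    - exists Rc. intros L HL. rewrite <- Hlin.
      apply Rle_trans with (RInt (fun y => f y + E * g y) (- Rc) Rc).
      + rewrite Hlin. assert (0 <= RInt g (- Rc) Rc) by (apply RInt_ge_0; [lra | easy | easy]).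
        nra.
      + apply RInt_le_wider; [ | lra | ].
        * intros y. apply continuous_ext with (fun y => 1 * f y + E * g y).
          { intros; f_equal; apply Rmult_1_l. }
          apply continuous_lin; apply continuous_heat_kernel_mult; try easy; lra.
        * intros y Hy. destruct (Rle_dec (Rabs y) (Rc + e)) as [Hye | Hye].
          { assert (0 <= f y) by (apply Rmult_le_pos;
              [left; now apply heat_kernel_pos | now apply Hin]).
            specialize (Hgpos y). nra. }
          { assert (Hdist : 0 <= e <= Rabs (r - y)).
            { split; [lra | ]. rewrite Rabs_minus_sym. pose proof (Rabs_triang_inv y r).
              rewrite (Rabs_right r) in * by lra. lra. }
            pose proof (heat_kernel_tail_le d e (r - y) Hd Hdist) as Ht. fold E in Ht.
            pose proof (heat_kernel_pos d (r - y) Hd) as Hk.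
            specialize (HAB y). unfold f, g, p. rewrite Rmult_1_r.
            assert (HP : 0 <= A + B * y ^ 2) by (pose proof (pow2_ge_0 y); nra).
            set (P := A + B * y ^ 2) in *.
            assert (- (heat_kernel d (r - y) * P) <= heat_kernel d (r - y) * w y) by nra.
            assert (heat_kernel d (r - y) * P <= E * heat_kernel (2 * d) (r - y) * P)
              by (apply Rmult_le_compat_r; lra).
            nra. }
    - apply is_lim_const.
    - apply is_lim_plus'; [apply Hv | ].
      apply (is_lim_scal_l (fun L => RInt g (- L) L) E p_infty (A * 1 + B * (r ^ 2 + 2 * d)) Hp). }
  pose proof (killed_half_op_fold d Rc w r Hd Cw Ew) as Hf.
  set (K := 8 * image_const Rc * d ^ 2).
  assert (HK : 0 <= K).
  { pose proof (image_const_pos Rc ltac:(lra)). unfold K. pose proof (pow2_ge_0 d). apply Rmult_le_pos; lra. }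
  assert (HW0 : 0 <= W).
  { apply Rle_trans with (w 0); [apply Hin; rewrite Rabs_R0; lra | apply HW; lra]. }
  assert (Hc : is_RInt (fun _ : R => K * W) 0 Rc (Rc * (K * W))).
  { evar_last; [apply (is_RInt_const 0 Rc (K * W)) | ].
    unfold scal; simpl; unfold mult; simpl; ring. }
  assert (Hsum := is_RInt_plus _ _ _ _ _ _ Hf Hc).
  assert (HT : killed_op d Rc w r <= RInt f (- Rc) Rc + Rc * (K * W)).
  { unfold killed_op.
    apply Rle_trans with (RInt (fun y => half_kernel d r y * w y + K * W) 0 Rc).
    2: right; exact (is_RInt_unique _ _ _ _ Hsum).
    apply RInt_le; [lra | now apply ex_RInt_killed_op | eexists; apply Hsum | ].
    intros y Hy.
    destruct (G_neum_bounds Rc d r y) as [_ HG]; try easy; try lra; try (rewrite Rabs_right; lra).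
    fold K in HG.
    assert (0 <= w y) by (apply Hin; rewrite Rabs_right; lra).
    assert (w y <= W) by (apply HW; lra).
    apply Rle_trans with ((half_kernel d r y + K) * w y); [apply Rmult_le_compat_r; lra | nra]. }
  assert (0 <= K * W) by (apply Rmult_le_pos; lra).
  rewrite Rmult_1_r in Hline. nra.
Qed.

(** * Comparison functions *)

(** A fixed point may jump to 0 at Rc, whereas the operator lemmas ask for continuity on the whole
    line; extension by constants keeps the values on [[0, Rc]]. It is continuous because the clamp
    is 1-Lipschitz with values in [[0, Rc]]. *)
Lemma continuous_clamp_comp (Rc : R) (rho : R -> R) (y : R) : 0 < Rc ->
  (forall x, 0 <= x <= Rc ->
     filterlim rho (within (fun y => 0 <= y <= Rc) (locally x)) (locally (rho x))) ->
  continuous (fun y => rho (Rmax 0 (Rmin y Rc))) y.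
Proof.
  intros HR Hrho. set (clamp := fun y => Rmax 0 (Rmin y Rc)).
  assert (Hin : forall x, 0 <= clamp x <= Rc).
  { intros x. unfold clamp, Rmax, Rmin. repeat destruct Rle_dec; lra. }
  apply (filterlim_comp _ _ _ clamp rho _ _ _) with (2 := Hrho (clamp y) (Hin y)).
  intros P [eps HP]. exists eps. intros x Hx. apply HP; [ | apply Hin].
  change (Rabs (x - y) < eps) in Hx. change (Rabs (clamp x - clamp y) < eps).
  apply Rle_lt_trans with (2 := Hx).
  unfold clamp, Rmax, Rmin. repeat destruct Rle_dec; unfold Rabs; repeat destruct Rcase_abs; lra.
Qed.

Definition killed_equation (j Rc d : R) (g : R -> R) : Prop :=
  forall r, 0 <= r <= Rc -> g r = j * d * G_neum d r 0 + killed_op d Rc g r.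

Lemma fixed_point_killed_equation (j Rc d : R) (rho : R -> R) :
  0 < Rc < 1 -> small_time Rc d -> admissible Rc rho -> fixed_point_with_cut j Rc d rho ->
  exists g, (forall y, continuous g y) /\ (forall r, 0 <= r <= Rc -> rho r = g r) /\
    killed_equation j Rc d g.
Proof.
  intros HR Hs [Hc H0] [_ Hfix].
  set (g := fun y => rho (Rmax 0 (Rmin y Rc))).
  assert (Cg : forall y, continuous g y) by (intros y; now apply continuous_clamp_comp).
  assert (Hg : forall r, 0 <= r <= Rc -> rho r = g r).
  { intros r Hr. unfold g. now rewrite Rmin_left, Rmax_right by lra. }
  exists g. split; [easy | split; [easy | ]].
  intros r Hr. rewrite <- (Hg r Hr), (Hfix r Hr). unfold conv_neum. f_equal.
  assert (H1 : is_RInt (fun y => G_neum d r y * rho y) 0 Rc (killed_op d Rc g r)).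
  { apply is_RInt_ext with (fun y => G_neum d r y * g y).
    - rewrite Rmin_left, Rmax_right by lra. intros y Hy. now rewrite Hg by lra.
    - apply (RInt_correct (fun y => G_neum d r y * g y)). now apply ex_RInt_killed_op. }
  assert (H2 : is_RInt (fun y => G_neum d r y * rho y) Rc 1 (scal (1 - Rc) 0)).
  { apply is_RInt_ext with (fun _ => 0).
    - rewrite Rmin_left, Rmax_right by lra. intros y Hy. rewrite H0 by lra. now rewrite Rmult_0_r.
    - apply (is_RInt_const Rc 1 0). }
  rewrite (is_RInt_unique _ _ _ _ (is_RInt_Chasles _ _ _ _ _ _ H1 H2)).
  unfold plus, scal; simpl; unfold mult; simpl. ring.
Qed.

(** One heat step lowers it by exactly [d], which makes it the strict supersolution. The form
    [_ * 1 + (- 1) * _] is the one that [line_conv_lin] produces; [cap] has it too. *)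
Definition parabola (a y : R) : R := a ^ 2 * 1 + (- 1) * y ^ 2.

Lemma continuous_parabola (a y : R) : continuous (parabola a) y.
Proof.
  apply (continuous_lin (fun _ => 1) (fun y => y ^ 2)); [apply continuous_const | apply continuous_sqr].
Qed.

Lemma line_conv_parabola (d a r : R) : 0 < d ->
  line_conv d (parabola a) r (a ^ 2 * 1 + (- 1) * (r ^ 2 + d)).
Proof.
  intros Hd. apply (line_conv_lin d (fun _ => 1) (fun y => y ^ 2)); try easy.
  - intros; apply continuous_const.
  - apply continuous_sqr.
  - now apply line_conv_one.
  - now apply line_conv_sqr.
Qed.

Lemma parabola_nonneg (a y : R) : Rabs y <= a -> 0 <= parabola a y.
Proof.
  intros Hy. unfold parabola. rewrite <- (pow2_abs y).
  assert (Rabs y ^ 2 <= a ^ 2) by (apply pow_incr; split; [apply Rabs_pos | easy]). lra.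
Qed.

Definition cap (d : R) (N : nat) (a y : R) : R := potential d N a * 1 + (- 1) * potential d N y.

Lemma continuous_cap (d : R) (N : nat) (a y : R) : 0 < d -> continuous (cap d N a) y.
Proof.
  intros Hd. apply (continuous_lin (fun _ => 1) (potential d N)); [apply continuous_const | ].
  now apply continuous_potential.
Qed.

Lemma line_conv_cap (d : R) (N : nat) (a r : R) : 0 < d ->
  line_conv d (cap d N a) r (cap d N a r - d * heat_kernel d r + d * heat_kernel (INR (S N) * d) r).
Proof.
  intros Hd.
  replace (cap d N a r - d * heat_kernel d r + d * heat_kernel (INR (S N) * d) r)
    with (potential d N a * 1 + (- 1) *
      (potential d N r + d * heat_kernel d r - d * heat_kernel (INR (S N) * d) r))
    by (unfold cap; ring).
  apply (line_conv_lin d (fun _ => 1) (potential d N)); try easy.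
  - intros; apply continuous_const.
  - intros; now apply continuous_potential.
  - now apply line_conv_one.
  - now apply line_conv_potential.
Qed.

Lemma cap_nonneg (d : R) (N : nat) (a y : R) : 0 < d -> Rabs y <= a -> 0 <= cap d N a y.
Proof.
  intros Hd Hy. unfold cap.
  assert (potential d N y <= potential d N a).
  { apply potential_mono; [easy | ]. rewrite <- (pow2_abs y). apply pow_incr.
    split; [apply Rabs_pos | easy]. }
  lra.
Qed.

(** [1728 = 27 * 4 ^ 3], from the cubic bound at [e ^ 2 / (4 * d)]; one power of [d] is given
    away. *)
Lemma exp_tail_le (e d : R) : 0 < e -> 0 < d < 1 ->
  exp (- (e ^ 2 / (4 * d))) <= 1728 / e ^ 6 * d ^ 2.
Proof.
  intros He Hd.
  assert (0 < 1728 / e ^ 6) by (apply Rdiv_lt_0_compat; [lra | now apply pow_lt]).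
  apply Rle_trans with (1728 / e ^ 6 * d ^ 3).
  - eapply Rle_trans; [apply exp_neg_le_cube, Rdiv_lt_0_compat; [now apply pow_lt | lra] | ].
    right. field. lra.
  - apply Rmult_le_compat_l; [lra | ]. nra.
Qed.

(** The gain [d] must beat two errors of order [d ^ 2]. Since [r ^ 2 + 2 * d <= 3], the tail costs
    [2 * 1728 * 3 = 10368] over [e ^ 6]; since [(Rc + e) ^ 2 <= 4], the images cost [8 * 4 = 32]
    times [image_const Rc]. *)
Lemma killed_op_parabola_lt (d Rc e r : R) : 0 < Rc < 1 -> small_time Rc d -> 0 < e <= 1 ->
  (10368 / e ^ 6 + 32 * image_const Rc) * d < 1 -> 0 <= r <= Rc ->
  killed_op d Rc (parabola (Rc + e)) r < parabola (Rc + e) r.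
Proof.
  intros HR Hs He Hsmall Hr. pose proof Hs as [Hd _].
  pose proof (exp_tail_le e d ltac:(lra) Hd) as Ht.
  assert (HT : killed_op d Rc (parabola (Rc + e)) r <=
    ((Rc + e) ^ 2 * 1 + (- 1) * (r ^ 2 + d)) + 2 * exp (- (e ^ 2 / (4 * d))) * (0 + 1 * (r ^ 2 + 2 * d))
    + 8 * image_const Rc * d ^ 2 * (Rc + e) ^ 2).
  { apply killed_op_le_line_conv; try easy; try lra.
    - intros; apply continuous_parabola.
    - intros y. unfold parabola. ring.
    - intros y Hy. now apply parabola_nonneg.
    - intros y Hy. unfold parabola. pose proof (pow2_ge_0 y). lra.
    - intros y. unfold parabola. pose proof (pow2_ge_0 (Rc + e)). lra.
    - apply line_conv_parabola; lra. }
  pose proof (image_const_pos Rc ltac:(lra)) as HK.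
  assert (Hq : 0 < 1728 / e ^ 6) by (apply Rdiv_lt_0_compat; [lra | apply pow_lt; lra]).
  assert (Hr3 : 0 <= r ^ 2 + 2 * d <= 3) by nra.
  assert (HR4 : 0 <= (Rc + e) ^ 2 <= 4) by nra.
  replace (10368 / e ^ 6) with (6 * (1728 / e ^ 6)) in Hsmall by (field; lra).
  set (q := 1728 / e ^ 6) in *. set (K := image_const Rc) in *.
  set (x := exp (- (e ^ 2 / (4 * d)))) in *.
  assert (Hx : 0 < x) by apply exp_pos.
  assert (E1 : x * (r ^ 2 + 2 * d) <= q * d ^ 2 * 3) by (apply Rmult_le_compat; lra).
  assert (Hd2 : 0 < d ^ 2) by (apply pow_lt; lra).
  assert (E2 : K * d ^ 2 * (Rc + e) ^ 2 <= K * d ^ 2 * 4)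
    by (apply Rmult_le_compat_l; [left; now apply Rmult_lt_0_compat | lra]).
  assert (E3 : (6 * q + 32 * K) * d * d < 1 * d) by (apply Rmult_lt_compat_r; lra).
  unfold parabola in *. nra.
Qed.

(** The point 0 is its own image under reflection at 0, so the source is at least
    [2 * j * d * heat_kernel d r]: hence the slope [2 * j]. The residual at time [INR (S N) * d]
    also has the favourable sign, so any N is allowed. *)
Lemma killed_equation_lower (j d Rc e r : R) (N : nat) (g : R -> R) :
  0 < j -> 0 < Rc < 1 -> small_time Rc d -> 0 < e <= 1 ->
  (10368 / e ^ 6 + 32 * image_const Rc) * d < 1 ->
  (forall y, continuous g y) -> killed_equation j Rc d g -> 0 <= r <= Rc ->
  2 * j * (potential d N Rc - potential d N r) <= g r.
Proof.
  intros Hj HR Hs He Hsmall Cg Hg Hr. pose proof Hs as [Hd _].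
  assert (Cc : forall y, continuous (cap d N Rc) y) by (intros; now apply continuous_cap).
  assert (H : 2 * j * cap d N Rc r + (- 1) * g r <= 0).
  { apply (killed_op_max_principle d Rc (parabola (Rc + e))
      (fun r => 2 * j * cap d N Rc r + (- 1) * g r)); try easy.
    - intros; apply continuous_parabola.
    - intros; now apply continuous_lin.
    - intros y Hy. unfold parabola. nra.
    - intros y Hy. now apply killed_op_parabola_lt.
    - intros x Hx. rewrite killed_op_lin by easy. rewrite (Hg x Hx).
      assert (Hc : cap d N Rc x - d * heat_kernel d x + d * heat_kernel (INR (S N) * d) x
        <= killed_op d Rc (cap d N Rc) x).
      { apply killed_op_ge_line_conv; try easy.
        - intros y. unfold cap. now rewrite potential_opp.
        - intros y Hy. apply cap_nonneg; [lra | ]. rewrite Rabs_right; lra.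
        - intros y Hy. unfold cap.
          assert (potential d N Rc <= potential d N y).
          { apply potential_mono; [lra | ]. rewrite <- (pow2_abs y). apply pow_incr. lra. }
          lra.
        - apply line_conv_cap; lra. }
      pose proof (heat_kernel_pos (INR (S N) * d) x (INR_S_mult_pos N d ltac:(lra))) as Hp.
      destruct (G_neum_bounds Rc d x 0) as [HG _]; try easy; try lra;
        try (rewrite Rabs_right; lra); try (rewrite Rabs_R0; lra).
      unfold half_kernel in HG. rewrite Rminus_0_r, Rplus_0_r in HG.
      assert (0 <= d * heat_kernel (INR (S N) * d) x) by (apply Rmult_le_pos; lra).
      assert (j * d * (heat_kernel d x + heat_kernel d x) <= j * d * G_neum d x 0)
        by (apply Rmult_le_compat_l; nra).
      nra. }
  unfold cap in H. lra.
Qed.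

(** The total coefficient of [d ^ 2] in the errors of the supersolution: Gaussian tail first, then
    distant images, including those of the source, which raise [14 * j] to [15 * j]. *)
Definition super_const (j Rc e : R) : R :=
  3456 / e ^ 6 * (16 * j + 3 * ((j + 1) * e))
  + 8 * image_const Rc * (15 * j + 4 * ((j + 1) * e)).

Lemma killed_equation_upper (j d Rc e r : R) (N : nat) (g : R -> R) :
  0 < j -> 0 < Rc < 1 -> small_time Rc d -> 0 < e <= 1 ->
  (10368 / e ^ 6 + 32 * image_const Rc) * d < 1 -> super_const j Rc e * d <= e ->
  (0 < N)%nat -> / e <= sqrt (INR N * d) ->
  (forall y, continuous g y) -> killed_equation j Rc d g -> 0 <= r <= Rc ->
  g r <= 2 * j * (potential d N (Rc + e) - potential d N r)
         + (j + 1) * e * ((Rc + e) ^ 2 - r ^ 2).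
Proof.
  intros Hj HR Hs He Hsmall Hsuper HN HNe Cg Hg Hr. pose proof Hs as [Hd _].
  set (k := (j + 1) * e). set (a := Rc + e).
  assert (Hk : 0 < k) by (unfold k; nra).
  assert (Ha : 0 < a <= 2) by (unfold a; lra).
  set (w := fun y => 2 * j * cap d N a y + k * parabola a y).
  assert (Cc : forall y, continuous (cap d N a) y) by (intros; now apply continuous_cap).
  assert (Cp : forall y, continuous (parabola a) y) by (intros; apply continuous_parabola).
  assert (Cw : forall y, continuous w y) by (intros; now apply continuous_lin).
  assert (Hinv : / sqrt (INR N * d) <= e).
  { rewrite <- (Rinv_inv e). apply Rinv_le_contravar; [apply Rinv_0_lt_compat; lra | easy]. }
  assert (Hsd : sqrt d <= 1) by (rewrite <- sqrt_1; apply sqrt_le_1_alt; lra).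
  assert (Hpot : forall y, 0 <= y -> potential d N y <= 1 + y + y ^ 2).
  { intros y Hy. pose proof (potential_le d N y ltac:(lra) Hy HN) as Hp.
    assert (y ^ 2 / sqrt (INR N * d) <= y ^ 2 * 1)
      by (apply Rmult_le_compat_l; [apply pow2_ge_0 | lra]). lra. }
  (* From [Hpot], the potential is at most [2 + 2 * y ^ 2], which gives the lower quadratic with
     [A = 4 * j] and [B = 4 * j + k]; at [a <= 2] it is at most 7, which gives
     [W = 14 * j + 4 * k]. *)
  assert (HT : forall x, 0 <= x <= Rc -> killed_op d Rc w x <=
    (2 * j * (cap d N a x - d * heat_kernel d x + d * heat_kernel (INR (S N) * d) x)
     + k * (a ^ 2 * 1 + (- 1) * (x ^ 2 + d)))
    + 2 * exp (- (e ^ 2 / (4 * d))) * (4 * j + (4 * j + k) * (x ^ 2 + 2 * d))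
    + 8 * image_const Rc * d ^ 2 * (14 * j + 4 * k)).
  { intros x Hx. apply killed_op_le_line_conv; try easy; try lra.
    - intros y. unfold w, cap, parabola. rewrite potential_opp. ring.
    - intros y Hy. unfold w.
      pose proof (cap_nonneg d N a y ltac:(lra) Hy). pose proof (parabola_nonneg a y Hy). nra.
    - intros y Hy. unfold w, cap, parabola.
      pose proof (potential_nonneg d N y ltac:(lra)). pose proof (Hpot a ltac:(lra)).
      assert (a ^ 2 <= 4) by nra. pose proof (pow2_ge_0 y). nra.
    - intros y. unfold w, cap, parabola.
      pose proof (potential_nonneg d N a ltac:(lra)).
      assert (Hpy : potential d N y <= 2 + 2 * y ^ 2).
      { replace (potential d N y) with (potential d N (Rabs y)).
        - pose proof (Hpot (Rabs y) (Rabs_pos y)). rewrite <- (pow2_abs y).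
          pose proof (Rabs_pos y). nra.
        - unfold Rabs. destruct Rcase_abs; [apply potential_opp | easy]. }
      pose proof (pow2_ge_0 a). nra.
    - apply (line_conv_lin d (cap d N a) (parabola a)); try easy.
      + apply line_conv_cap; lra.
      + apply line_conv_parabola; lra. }
  assert (H : 1 * g r + (- 1) * w r <= 0).
  { apply (killed_op_max_principle d Rc (parabola a) (fun r => 1 * g r + (- 1) * w r)); try easy.
    - intros; now apply continuous_lin.
    - intros y Hy. unfold parabola, a. nra.
    - intros y Hy. now apply killed_op_parabola_lt.
    - intros x Hx. rewrite killed_op_lin by easy. rewrite (Hg x Hx).
      specialize (HT x Hx).
      destruct (G_neum_bounds Rc d x 0) as [_ HG]; try easy; try lra;
        try (rewrite Rabs_right; lra); try (rewrite Rabs_R0; lra).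
      unfold half_kernel in HG. rewrite Rminus_0_r, Rplus_0_r in HG.
      assert (HNd : 0 < INR N * d) by (apply Rmult_lt_0_compat; [now apply lt_0_INR | lra]).
      assert (Hres : heat_kernel (INR (S N) * d) x <= e / 2).
      { eapply Rle_trans; [apply heat_kernel_le_inv_sqrt, INR_S_mult_pos; lra | ].
        pose proof (sqrt_lt_R0 _ HNd).
        assert (sqrt (INR N * d) <= sqrt (INR (S N) * d))
          by (apply sqrt_le_1_alt; rewrite S_INR; lra).
        apply Rle_trans with (/ (2 * sqrt (INR N * d))); [apply Rinv_le_contravar; lra | ].
        rewrite Rinv_mult. lra. }
      pose proof (exp_tail_le e d ltac:(lra) Hd) as Ht.
      pose proof (image_const_pos Rc ltac:(lra)) as HK.
      assert (Hx3 : 0 <= x ^ 2 + 2 * d <= 3) by nra.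
      unfold super_const in Hsuper. fold k in Hsuper.
      assert (Hq : 0 < 1728 / e ^ 6) by (apply Rdiv_lt_0_compat; [lra | apply pow_lt; lra]).
      replace (3456 / e ^ 6) with (2 * (1728 / e ^ 6)) in Hsuper by (field; lra).
      set (q := 1728 / e ^ 6) in *. set (K := image_const Rc) in *.
      set (z := exp (- (e ^ 2 / (4 * d)))) in *.
      assert (Hz : 0 < z) by apply exp_pos.
      assert (Hd2 : 0 < d ^ 2 <= d) by nra.
      assert (E1 : z * (4 * j + (4 * j + k) * (x ^ 2 + 2 * d)) <= q * d ^ 2 * (16 * j + 3 * k)).
      { apply Rmult_le_compat; nra. }
      assert (E2 : j * d * G_neum d x 0 <= j * d * (heat_kernel d x + heat_kernel d x + 8 * K * d ^ 2))
        by (apply Rmult_le_compat_l; [nra | lra]).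
      assert (E3 : j * d * (8 * K * d ^ 2) <= 8 * K * d ^ 2 * j).
      { replace (j * d * (8 * K * d ^ 2)) with (d * (8 * K * d ^ 2 * j)) by ring.
        assert (0 < 8 * K * d ^ 2 * j) by (apply Rmult_lt_0_compat; [apply Rmult_lt_0_compat | ]; lra). nra. }
      assert (E4 : 2 * j * (d * heat_kernel (INR (S N) * d) x) <= j * d * e).
      { replace (j * d * e) with (2 * j * (d * (e / 2))) by field.
        apply Rmult_le_compat_l; [lra | ]. apply Rmult_le_compat_l; lra. }
      assert (E5 : (2 * q * (16 * j + 3 * k) + 8 * K * (15 * j + 4 * k)) * d * d <= e * d)
        by (apply Rmult_le_compat_r; lra).
      (* The reason for the factor [j + 1]: the part [j * d * e] pays for the residual kernel
         ([E4]), the part [e * d] for all errors of order [d ^ 2] ([E5]). *)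
      assert (Hkd : k * d = j * d * e + e * d) by (unfold k; ring).
      unfold w at 1. unfold parabola at 1.
      nra. }
  unfold w, cap, parabola in H. lra.
Qed.

(** * Choice of parameters and the limit *)

Lemma small_mult (C c : R) : 0 < C -> 0 < c ->
  exists d0, 0 < d0 /\ forall d, 0 < d < d0 -> C * d < c.
Proof.
  intros HC Hc. exists (c / C). split; [now apply Rdiv_lt_0_compat | ].
  intros d [_ Hd]. replace c with (C * (c / C)) by (field; lra).
  now apply Rmult_lt_compat_l.
Qed.

Lemma killed_equation_close (j Rc r e : R) :
  0 < j -> 0 < Rc < 1 -> 0 <= r <= Rc -> 0 < e <= 1 ->
  exists d0, 0 < d0 /\ forall d, 0 < d < d0 -> small_time Rc d /\
    forall g, (forall y, continuous g y) -> killed_equation j Rc d g ->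
      Rabs (g r - 2 * j * (Rc - r)) <= (20 * j + 4) * e.
Proof.
  intros Hj HR Hr He.
  pose proof (image_const_pos Rc ltac:(lra)) as HK.
  assert (He2 : 0 < e ^ 2) by (apply pow_lt; lra).
  assert (Hq : 0 < / e ^ 6) by (apply Rinv_0_lt_compat, pow_lt; lra).
  assert (Hje : 0 < j * e) by (apply Rmult_lt_0_compat; lra).
  assert (B1 : Rc ^ 2 * e <= 1 * e) by (apply Rmult_le_compat_r; nra).
  assert (B2 : r ^ 2 * e <= 1 * e) by (apply Rmult_le_compat_r; nra).
  assert (HRe : (Rc + e) ^ 2 <= 4) by nra.
  assert (B3 : (Rc + e) ^ 2 * e <= 4 * e) by (apply Rmult_le_compat_r; lra).
  assert (B4 : (j + 1) * e * ((Rc + e) ^ 2 - r ^ 2) <= (j + 1) * e * 4).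
  { pose proof (pow2_ge_0 r). apply Rmult_le_compat_l; lra. }
  destruct (small_mult (image_const Rc) (1 / 2)) as [d1 [Hd1 S1]]; [easy | lra | ].
  destruct (small_mult (10368 / e ^ 6 + 32 * image_const Rc) 1) as [d2 [Hd2 S2]];
    [unfold Rdiv; nra | lra | ].
  destruct (small_mult (super_const j Rc e) e) as [d3 [Hd3 S3]]; [ | lra | ].
  { unfold super_const, Rdiv. assert (0 < (j + 1) * e) by nra.
    apply Rplus_lt_0_compat; apply Rmult_lt_0_compat; lra. }
  destruct (drop_int_small Rc e) as [d4 [Hd4 S4]]; [lra | lra | ].
  destruct (drop_int_small r e) as [d5 [Hd5 S5]]; [lra | lra | ].
  exists (Rmin 1 (Rmin (e ^ 2) (Rmin d1 (Rmin d2 (Rmin d3 (Rmin d4 d5)))))).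
  split; [now repeat apply Rmin_glb_lt; try lra | ].
  intros d [Hd Hmin].
  do 6 (apply Rmin_Rgt_l in Hmin; destruct Hmin as [? Hmin]).
  assert (Hs : small_time Rc d) by (split; [lra | left; apply S1; lra]).
  split; [easy | ]. intros g Cg Hg.
  (* N is chosen after [d]; none of the thresholds entering [d0] depends on it. *)
  destruct (INR_unbounded (/ (e ^ 2 * d))) as [N HNbig].
  assert (Hinvpos : 0 < / (e ^ 2 * d)) by (apply Rinv_0_lt_compat, Rmult_lt_0_compat; lra).
  assert (HN : (0 < N)%nat) by (apply INR_lt; simpl; lra).
  assert (HNe : / e <= sqrt (INR N * d)).
  { rewrite <- (sqrt_pow2 (/ e)) by (left; apply Rinv_0_lt_compat; lra).
    apply sqrt_le_1_alt.
    replace ((/ e) ^ 2) with (/ (e ^ 2 * d) * d) by (field; lra).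
    apply Rmult_le_compat_r; lra. }
  assert (Hinv : / sqrt (INR N * d) <= e).
  { rewrite <- (Rinv_inv e). apply Rinv_le_contravar; [apply Rinv_0_lt_compat; lra | easy]. }
  assert (Hsq : forall x, x ^ 2 / sqrt (INR N * d) <= x ^ 2 * e)
    by (intros x; apply Rmult_le_compat_l; [apply pow2_ge_0 | easy]).
  assert (Hsd : sqrt d <= e).
  { rewrite <- (sqrt_pow2 e) by lra. apply sqrt_le_1_alt; lra. }
  pose proof (killed_equation_lower j d Rc e r N g Hj HR Hs He (S2 d ltac:(lra)) Cg Hg Hr) as HL.
  pose proof (killed_equation_upper j d Rc e r N g Hj HR Hs He (S2 d ltac:(lra))
    (Rlt_le _ _ (S3 d ltac:(lra))) HN HNe Cg Hg Hr) as HU.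
  pose proof (potential_ge d N Rc Hd ltac:(lra) HN) as P1.
  pose proof (potential_le d N r Hd ltac:(lra) HN) as P2.
  pose proof (potential_le d N (Rc + e) Hd ltac:(lra) HN) as P3.
  pose proof (potential_ge d N r Hd ltac:(lra) HN) as P4.
  pose proof (Hsq Rc). pose proof (Hsq r). pose proof (Hsq (Rc + e)).
  pose proof (S4 d ltac:(lra)). pose proof (S5 d ltac:(lra)).
  (* Each potential at Rc or [r] is off by at most [2 * e]. The one at [Rc + e] exceeds Rc by at
     most [6 * e]: the shift, [sqrt d], and [4 * e] from the quadratic term. With the parabola's
     [4 * (j + 1) * e] the upper error is [(16 * j + 4 * j + 4) * e]. *)
  assert (L : Rc - r - 4 * e <= potential d N Rc - potential d N r) by lra.
  assert (U : potential d N (Rc + e) - potential d N r <= Rc - r + 8 * e) by lra.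
  apply (Rmult_le_compat_l (2 * j)) in L; [ | lra].
  apply (Rmult_le_compat_l (2 * j)) in U; [ | lra].
  apply Rabs_le. split; lra.
Qed.

Theorem theorem3p3 (j Rc : R) (hj : 0 < j) (hR : 0 < Rc < 1)
  (rho : R -> R -> R)
  (hrho : exists delta0 : R, 0 < delta0 /\
     forall delta : R, 0 < delta < delta0 ->
       admissible Rc (rho delta) /\ fixed_point_with_cut j Rc delta (rho delta)) :
  forall r : R, 0 <= r <= Rc ->
    filterlim (fun delta => rho delta r) (at_right 0) (locally (2 * j * (Rc - r))).
Proof.
  intros r Hr. destruct hrho as [delta0 [H0 Hfix]].
  intros P [eps HP].
  (* Dividing by [20 * j + 5] instead of [20 * j + 4] makes the final inequality strict. *)
  set (e := Rmin 1 (eps / (20 * j + 5))).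
  assert (Heps : 0 < eps / (20 * j + 5)) by (apply Rdiv_lt_0_compat; [apply cond_pos | lra]).
  assert (He : 0 < e <= 1) by (split; [apply Rmin_glb_lt; lra | apply Rmin_l]).
  assert (Hlt : (20 * j + 4) * e < eps).
  { assert (e <= eps / (20 * j + 5)) by apply Rmin_r.
    assert ((20 * j + 5) * e <= eps).
    { replace (pos eps) with ((20 * j + 5) * (eps / (20 * j + 5))) by (field; lra).
      apply Rmult_le_compat_l; lra. }
    lra. }
  destruct (killed_equation_close j Rc r e hj hR Hr He) as [d0 [Hd0 Hclose]].
  assert (Hm : 0 < Rmin delta0 d0) by (now apply Rmin_glb_lt).
  exists (mkposreal _ Hm). intros d Hball Hd.
  change (Rabs (d - 0) < Rmin delta0 d0) in Hball.
  rewrite Rminus_0_r, Rabs_right in Hball by lra.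
  pose proof (Rmin_l delta0 d0). pose proof (Rmin_r delta0 d0).
  destruct (Hfix d ltac:(lra)) as [Hadm Hcut].
  destruct (Hclose d ltac:(lra)) as [Hs Hg].
  destruct (fixed_point_killed_equation j Rc d (rho d) hR Hs Hadm Hcut) as [g [Cg [Heq Hk]]].
  apply HP. change (Rabs (rho d r - 2 * j * (Rc - r)) < eps).
  rewrite (Heq r Hr). apply Rle_lt_trans with (2 := Hlt). now apply Hg.
Qed.
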